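(* Let $a<b$ and let $\sigma:[a,b]\to[0,\infty)$ satisfy $\sigma(a)=\sigma(b)=0$, $\sigma(x)>0$ for all $x\in(a,b)$, and $\sigma$ locally Hölder-$1/2$ continuous on $(a,b)$. Suppose in addition that $\sigma$ is bounded on $[a,b]$. Let $Z$ be an $[a,b]$-valued martingale solving $$dZ_t=\sigma(Z_t)\,dW_t,\qquad Z_0=z,\qquad a<z<b,$$ where $W$ is a standard Brownian motion, and let $\tau=\inf\{t>0:Z_t\in\{a,b\}\}$ be the first hitting time of $\{a,b\}$. Then $$\mathbb{P}(\tau>t)>0\qquad\text{for all } t>0.$$
   Context: Locally Hölder-$1/2$ continuous on $(a,b)$ means: for every compact $K\subset(a,b)$ there is $C_K$ with $|\sigma(x)-\sigma(y)|\le C_K|x-y|^{1/2}$ for all $x,y\in K$. *)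

(* Defs.v *)
From HB Require Import structures.
From mathcomp Require Import all_boot all_order all_algebra.
From mathcomp Require Import all_classical all_reals all_analysis.
Set Implicit Arguments.
Unset Strict Implicit.
Unset Printing Implicit Defensive.
Import Order.TTheory GRing.Theory Num.Theory.
Import numFieldNormedType.Exports.
Local Open Scope classical_set_scope.
Local Open Scope ring_scope.

Definition locally_hoelder (R : realType) (al : R) (U : set R) (f : R -> R) :=
  forall K : set R, compact K -> K `<=` U ->
    exists C : R, forall x y, K x -> K y -> `|f x - f y| <= C * `|x - y| `^ al.

(* Processes are indexed by R but only times in [0, +oo[ are meaningful: every
   definition below ignores the values at negative times. *)
Section processes.
Context {d : measure_display} {T : measurableType d} {R : realType}.
Variable P : probability T R.
Implicit Types (F : R -> set (set T)) (G : set (set T)) (X W H : R -> T -> R).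

Definition filtration F :=
  [/\ forall t, 0 <= t -> sigma_algebra setT (F t),
      forall t, 0 <= t -> F t `<=` measurable
    & forall s t, 0 <= s -> s <= t -> F s `<=` F t].

Definition measurable_wrt G (f : T -> R) :=
  measurable_fun [set: g_sigma_algebraType G] (f : g_sigma_algebraType G -> R).

Definition adapted F X := forall t, 0 <= t -> measurable_wrt (F t) (X t).

(* The restriction of X to [0, t] x T is B([0, t]) (x) F_t - measurable. *)
Definition progressive_at F X (t : R) :=
  measurable_fun (`[0, t]%classic `*` [set: g_sigma_algebraType (F t)])
    (fun p : R * g_sigma_algebraType (F t) => X p.1 p.2).

Definition continuous_path X (w : T) :=
  {within `[0, +oo[%classic, continuous (fun t => X t w)}.

Definition is_cond_exp G (f g : T -> R) :=
  [/\ measurable_wrt G g, P.-integrable setT (EFin \o g)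
    & forall A, G A -> (\int[P]_(w in A) (g w)%:E = \int[P]_(w in A) (f w)%:E)%E].

Definition martingale F X :=
  [/\ adapted F X,
      forall t, 0 <= t -> P.-integrable setT (EFin \o X t)
    & forall s t, 0 <= s -> s <= t -> is_cond_exp (F s) (X t) (X s)].

Definition increment W (s t : R) (w : T) : R := W t w - W s w.

(* The second parameter of normal_prob is the standard deviation. *)
Definition brownian_motion F W :=
  [/\ adapted F W,
      {ae P, forall w, W 0 w = 0},
      {ae P, forall w, continuous_path W w},
      forall s t, 0 <= s -> s < t -> forall B : set R, measurable B ->
        P (increment W s t @^-1` B) = normal_prob 0 (Num.sqrt (t - s)) B
    & forall s t, 0 <= s -> s < t -> forall (A : set T) (B : set R),
        F s A -> measurable B ->
        (P (A `&` increment W s t @^-1` B) = P A * P (increment W s t @^-1` B))%E].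

(* The data (n, tt, xi) encode the process
   sum_(i < n) xi_i 1_(]tt_i, tt_(i+1)]). *)
Record simple_process := SimpleProcess {
  sp_len : nat;
  sp_time : nat -> R;
  sp_coef : nat -> T -> R }.

Definition is_simple F (S : simple_process) :=
  [/\ 0 <= sp_time S 0%N,
      forall i, (i < sp_len S)%N -> sp_time S i <= sp_time S i.+1
    & forall i, (i < sp_len S)%N ->
        measurable_wrt (F (sp_time S i)) (sp_coef S i) /\
        [bounded sp_coef S i w | w in [set: T]] ].

Definition sp_val (S : simple_process) (s : R) (w : T) : R :=
  \sum_(i < sp_len S)
    sp_coef S i w * \1_(`]sp_time S i, sp_time S i.+1]%classic) s.

Definition sp_int W (S : simple_process) (t : R) (w : T) : R :=
  \sum_(i < sp_len S) sp_coef S i w *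
    (W (Num.min (sp_time S i.+1) t) w - W (Num.min (sp_time S i) t) w).

(* X is (a version of) the Ito integral of H against W over [0, t], for H
   progressive and square integrable: the L^2(P) limit of the elementary
   integrals of simple processes converging to H in L^2(P (x) ds). *)
Definition is_ito_integral F W H (t : R) (X : T -> R) :=
  [/\ forall s, 0 <= s <= t -> progressive_at F H s,
      (\int[P]_w \int[lebesgue_measure]_(s in `[0%R, t]) ((H s w) ^+ 2)%R%:E
         < +oo)%E,
      measurable_fun setT X
    & exists S : nat -> simple_process,
        [/\ forall n, is_simple F (S n),
            (fun n => \int[P]_w \int[lebesgue_measure]_(s in `[0%R, t])
               ((H s w - sp_val (S n) s w) ^+ 2)%R%:E)%E @ \oo --> 0%E
          & (fun n => \int[P]_w ((X w - sp_int W (S n) t w) ^+ 2)%R%:E)%E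
               @ \oo --> 0%E] ].

(* dZ_t = sigma(Z_t) dW_t, Z_0 = z. All paths of Z are required to be continuous,
   so that hitting times of closed sets by Z give rise to events of T. *)
Definition sde_solution F W (sigma : R -> R) (z : R) (Z : R -> T -> R) :=
  [/\ adapted F Z,
      forall w, continuous_path Z w,
      {ae P, forall w, Z 0 w = z}
    & forall t, 0 <= t ->
        is_ito_integral F W (fun s w => sigma (Z s w)) t (fun w => Z t w - z)].

Definition hitting_time X (A : set R) (w : T) : \bar R :=
  ereal_inf [set t%:E | t in [set t : R | 0 < t /\ A (X t w)]].

End processes.

(* Main.v *)
Require Import Defs.
From HB Require Import structures.
From mathcomp Require Import all_boot all_order all_algebra.
From mathcomp Require Import all_classical all_reals all_analysis.
From mathcomp Require Import measurable_realfun ring lra.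
Import Order.TTheory GRing.Theory Num.Theory.
Import numFieldNormedType.Exports.
Local Open Scope classical_set_scope.
Local Open Scope ring_scope.

(** Idea. Put [L = b - a] and [f x = ((x - a) * (b - x)) ^+ 2], positive inside
    the interval and zero at its ends. If Itô's formula were applied to f(Z), the
    drift would be f''(Z) sigma(Z)^2 / 2, and f'' >= - (16 / L^2) f, because f
    vanishes to second order at a and b. As sigma is bounded, E f(Z_t) would
    decay at most exponentially in t; it would stay positive, as would the
    probability that Z avoids the end points. In other words, Z is a Brownian
    motion run for at most M^2 t units of time, and a Brownian motion stays in an
    interval for any given time with positive probability.

    The proof carries this out in discrete time. From the definition of the
    stochastic integral, only the bound
    E[G (Z_t - Z_s)^2] <= V (t - s) E[G], for bounded F_s-measurable G >= 0, is
    extracted ([increment_variance]). It comes from the isometry for simple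
    processes ([brownian_sumP]), which rests on [pull_out] and on the moments of
    Gaussian variables, and from a pathwise comparison of the bracket of the
    simple process with its distance to sigma(Z) ([bracket_le_integral]).

    Along a grid of [0, t], the Taylor bound [bump_taylor] replaces Itô's
    formula: the first order term vanishes in the mean because Z is a martingale,
    the second order term is controlled by the variance bound and by f itself,
    and a fourth order remainder is left. The latter is negligible as long as
    the increments are small, so the paths are killed at the first large
    increment; they are also killed when f(Z) falls below a level delta. The
    surviving weight is bounded below ([survival_lower_bound]). As the mesh tends
    to 0, large increments disappear by uniform continuity of the paths, and in
    the limit f(Z) >= delta on [0, t] with positive probability
    ([stays_above_pos]). On that event the hitting time exceeds t. *)

Set Implicit Arguments.
Unset Strict Implicit.
Unset Printing Implicit Defensive.

(** * Expectation of integrable, square integrable and bounded variables *)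

Section expectation.
Context {d : measure_display} {T : measurableType d} {R : realType}.
Variable P : probability T R.
Implicit Types f g : T -> R.

Definition intg f := P.-integrable setT (EFin \o f).
Definition square_intg f := measurable_fun setT f /\ intg (fun w => f w ^+ 2).
Definition bounded_rv f :=
  measurable_fun setT f /\ exists M, forall w, `|f w| <= M.
Definition Ex f : R := Rintegral P setT f.

Lemma intg_meas f : intg f -> measurable_fun setT f.
Proof. by move=> /measurable_int /measurable_EFinP. Qed.

Lemma intg_le f g : measurable_fun setT f -> (forall w, `|f w| <= `|g w|) ->
  intg g -> intg f.
Proof.
move=> mf fg; apply: le_integrable => //; first exact/measurable_EFinP.
by move=> w _; rewrite /= lee_fin.
Qed.

Lemma intgD f g : intg f -> intg g -> intg (fun w => f w + g w).
Proof. by move=> hf hg; exact: integrableD hf hg. Qed.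

Lemma intgZ k f : intg f -> intg (fun w => k * f w).
Proof. by move=> hf; exact: integrableZl hf. Qed.

Lemma intgN f : intg f -> intg (fun w => - f w).
Proof. by move=> hf; exact: integrableN hf. Qed.

Lemma intgB f g : intg f -> intg g -> intg (fun w => f w - g w).
Proof. by move=> hf hg; apply: intgD => //; exact: intgN. Qed.

Lemma intg_cst k : intg (fun=> k).
Proof. exact: finite_measure_integrable_cst. Qed.

Lemma bounded_intg f : bounded_rv f -> intg f.
Proof.
move=> [mf [M fM]]; apply: intg_le (intg_cst M) => // w.
by rewrite (le_trans (fM w))// ler_norm.
Qed.

Lemma intgM_bounded f g : bounded_rv f -> intg g -> intg (fun w => f w * g w).
Proof.
move=> [mf [M fM]] hg; apply: intg_le (intgZ M hg) => [|w].
  by apply: measurable_funM => //; exact: intg_meas.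
rewrite !normrM ler_wpM2r//; apply: le_trans (fM w) _; exact: ler_norm.
Qed.

Lemma ExD f g : intg f -> intg g -> Ex (fun w => f w + g w) = Ex f + Ex g.
Proof. by move=> hf hg; rewrite /Ex RintegralD. Qed.

Lemma ExB f g : intg f -> intg g -> Ex (fun w => f w - g w) = Ex f - Ex g.
Proof. by move=> hf hg; rewrite /Ex RintegralB. Qed.

Lemma ExZ k f : intg f -> Ex (fun w => k * f w) = k * Ex f.
Proof. by move=> hf; rewrite /Ex RintegralZl. Qed.

Lemma Ex_le f g : intg f -> intg g -> (forall w, f w <= g w) -> Ex f <= Ex g.
Proof. by move=> hf hg fg; apply: le_Rintegral => // w _. Qed.

Lemma Ex_ge0 f : (forall w, 0 <= f w) -> 0 <= Ex f.
Proof. by move=> f0; apply: Rintegral_ge0 => w _. Qed.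

Lemma Ex_cst k : Ex (fun=> k) = k.
Proof.
rewrite /Ex Rintegral_cst//; have -> : fine (P setT) = 1.
  by rewrite probability_setT.
by rewrite mulr1.
Qed.

Lemma eq_Ex f g : f =1 g -> Ex f = Ex g.
Proof. by move=> fg; congr Ex; exact/funext. Qed.

Lemma Ex_EFin f : intg f -> (\int[P]_w (f w)%:E)%E = (Ex f)%:E.
Proof. by move=> hf; rewrite fineK//; exact: integrable_fin_num. Qed.

Lemma bounded_square f : bounded_rv f -> square_intg f.
Proof.
move=> [mf [M fM]]; split=> //; apply: bounded_intg; split.
  exact: measurable_funX.
exists (M ^+ 2) => w; rewrite normrX lerXn2r ?nnegrE//.
exact: le_trans (fM w).
Qed.

Lemma squareM f g : square_intg f -> square_intg g -> intg (fun w => f w * g w).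
Proof.
move=> [mf f2] [mg g2]; apply: intg_le (intgD f2 g2) => [|w].
  exact: measurable_funM.
rewrite [leRHS]ger0_norm ?addr_ge0 ?sqr_ge0// ler_norml; apply/andP; split; nra.
Qed.

Lemma squareD f g : square_intg f -> square_intg g ->
  square_intg (fun w => f w + g w).
Proof.
move=> hf hg; split; first by apply: measurable_funD; [case: hf|case: hg].
rewrite (_ : (fun _ => _) = fun w => f w ^+ 2 + (2 * (f w * g w) + g w ^+ 2)).
  apply: intgD; first by case: hf.
  by apply: intgD; [apply/intgZ/squareM|case: hg].
by apply/funext => w; ring.
Qed.

Lemma squareM_bounded f g : bounded_rv f -> square_intg g ->
  square_intg (fun w => f w * g w).
Proof.
move=> [mf [M fM]] [mg g2]; split; first exact: measurable_funM.
apply: intg_le (intgZ (M ^+ 2) g2) => [|w].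
  by apply: measurable_funX; exact: measurable_funM.
have fM2 : `|f w| <= `|M| by rewrite (le_trans (fM w))// ler_norm.
rewrite exprMn [leLHS]normrM [leRHS]normrM ler_wpM2r// !(normrX 2).
by rewrite ler_sqr ?nnegrE.
Qed.

Lemma bounded_cst k : bounded_rv (fun=> k).
Proof. by split=> //; exists `|k|. Qed.

Lemma square_intg_intg f : square_intg f -> intg f.
Proof.
move=> hf; have := squareM (bounded_square (bounded_cst 1)) hf.
by under [X in intg X -> _]eq_fun do rewrite mul1r.
Qed.

Lemma squareN f : square_intg f -> square_intg (fun w => - f w).
Proof.
move=> hf; have := squareM_bounded (bounded_cst (-1)) hf.
by under [X in square_intg X -> _]eq_fun do rewrite mulN1r.
Qed.

Lemma squareB f g : square_intg f -> square_intg g ->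
  square_intg (fun w => f w - g w).
Proof. by move=> hf hg; apply: squareD => //; exact: squareN. Qed.

Lemma bounded_rvM f g : bounded_rv f -> bounded_rv g ->
  bounded_rv (fun w => f w * g w).
Proof.
move=> [mf [M fM]] [mg [N gN]]; split; first exact: measurable_funM.
by exists (M * N) => w; rewrite normrM ler_pM.
Qed.

Lemma bounded_rvD f g : bounded_rv f -> bounded_rv g ->
  bounded_rv (fun w => f w + g w).
Proof.
move=> [mf [M fM]] [mg [N gN]]; split; first exact: measurable_funD.
by exists (M + N) => w; rewrite (le_trans (ler_normD _ _))// lerD.
Qed.

Lemma bounded_rv_indic A : measurable A -> bounded_rv (\1_A : T -> R).
Proof.
move=> mA; split; first exact: measurable_indic.
by exists 1 => w; rewrite indicE; case: (_ \in _); rewrite ?normr1 ?normr0.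
Qed.

Lemma Ex_indic A : measurable A -> (Ex \1_A)%:E = P A.
Proof.
move=> mA; rewrite -Ex_EFin; last exact/bounded_intg/bounded_rv_indic.
by rewrite integral_indic// setIT.
Qed.

Lemma Ex_dominated (f_ : nat -> T -> R) f g :
  (forall n, measurable_fun setT (f_ n)) -> measurable_fun setT f ->
  (forall w, f_ ^~ w @ \oo --> f w) -> intg g ->
  (forall n w, `|f_ n w| <= g w) -> Ex (f_ n) @[n --> \oo] --> Ex f.
Proof.
move=> mf_ mf f_f gi f_g.
have fi n : intg (f_ n).
  by apply: intg_le gi => // w; rewrite (le_trans (f_g n w))// ler_norm.
have f_fE w : (f_ n w)%:E @[n --> \oo] --> (f w)%:E.
  by apply/fine_cvgP; split; [exact: nearW|exact: f_f].
have [fi' _ cvgi] : [/\ intg f, True & (fun n => \int[P]_w (f_ n w)%:E)%E @ \oo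
    --> (\int[P]_w (f w)%:E)%E].
  have [h1 _ h2] := @dominated_convergence _ T R P setT measurableT
    (fun n w => (f_ n w)%:E) (EFin \o f) (EFin \o g)
    (fun n => (measurable_EFinP _ _).2 (mf_ n)) ((measurable_EFinP _ _).2 mf)
    (aeW P (fun w _ => f_fE w)) gi
    (aeW P (fun w n _ => f_g n w)).
  by split.
by apply: fine_cvg; rewrite fineK//; exact: integrable_fin_num.
Qed.

End expectation.

(** * Conditional mean zero and taking out what is known *)

Section conditional.
Context {d : measure_display} {T : measurableType d} {R : realType}.
Variable P : probability T R.
Implicit Types (f g Y : T -> R) (G : set (set T)).

Lemma measurable_wrt_meas G f : G `<=` measurable -> measurable_wrt G f ->
  measurable_fun setT f.
Proof.
move=> Gm mf mT B mB; have := mf measurableT B mB.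
by apply: smallest_sub => //; exact: sigma_algebra_measurable.
Qed.

Lemma measurable_wrt_sub G G' f : G `<=` G' -> measurable_wrt G f ->
  measurable_wrt G' f.
Proof.
move=> GG' mf _ B mB; have := mf measurableT B mB.
exact: sub_sigma_algebra2.
Qed.

Lemma measurable_wrt_preimage G f (B : set R) : sigma_algebra setT G ->
  measurable_wrt G f -> measurable B -> G (f @^-1` B).
Proof.
move=> sG mf mB; have := mf measurableT B mB.
by rewrite setTI /measurable/= sigma_algebra_id.
Qed.

Lemma measurable_wrt_indic G A : G A -> measurable_wrt G (\1_A : T -> R).
Proof.
move=> GA; apply: (@measurable_indic _ (g_sigma_algebraType G)).
exact: sub_sigma_algebra.
Qed.

(** This is E[f | G] = 0, tested on the sets of G. Increments of martingales
    and centred functions of Brownian increments are the two instances. *)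
Definition cond_mean0 G f :=
  intg P f /\ forall A, G A -> Ex P (fun w => \1_A w * f w) = 0.

Import HBNNSimple.

Lemma cond_mean0_nnsfun G f (h : {nnsfun (g_sigma_algebraType G) >-> R}) :
  sigma_algebra setT G -> G `<=` measurable -> cond_mean0 G f ->
  Ex P (fun w => h w * f w) = 0.
Proof.
move=> sG Gm [fi f0].
have Gh r : G (h @^-1` [set r]).
  have : measurable_fun setT h by exact: measurable_funP.
  by move/(measurable_wrt_preimage sG); apply.
have iT r : intg P (fun w => \1_(h @^-1` [set r]) w * f w).
  by apply: intgM_bounded fi; apply: bounded_rv_indic; exact: Gm.
have iZ r : intg P (fun w => r * \1_(h @^-1` [set r]) w * f w).
  by under eq_fun do rewrite -mulrA; exact: intgZ (iT r).
have ExZ0 r : Ex P (fun w => r * \1_(h @^-1` [set r]) w * f w) = 0.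
  by under eq_Ex do rewrite -mulrA; rewrite (ExZ _ (iT r)) f0// mulr0.
under eq_Ex do rewrite fimfunEord mulr_suml.
rewrite /Ex /Rintegral; under eq_integral do rewrite -sumEFin.
rewrite integral_sum//; last by move=> i; exact: iZ.
by rewrite big1// => i _; rewrite (Ex_EFin (iZ _)) ExZ0.
Qed.

Lemma pull_out_ge0 G f Y : sigma_algebra setT G -> G `<=` measurable ->
  cond_mean0 G f -> measurable_wrt G Y -> (forall w, 0 <= Y w) ->
  intg P (fun w => Y w * f w) -> Ex P (fun w => Y w * f w) = 0.
Proof.
move=> sG Gm mf mY Y0 iYf.
have mY' : measurable_fun [set: g_sigma_algebraType G]
    (EFin \o (Y : g_sigma_algebraType G -> R)) by exact/measurable_EFinP.
pose h := nnsfun_approx measurableT mY'.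
have hY w : EFin \o h ^~ w @ \oo --> (Y w)%:E.
  by apply: cvg_nnsfun_approx => // x _; rewrite lee_fin.
have mh n : measurable_fun setT (h n : T -> R).
  by apply: (measurable_wrt_meas Gm); exact: measurable_funP.
have hle n w : h n w <= Y w.
  have /= -> : h n w = approx setT (EFin \o Y) n w by rewrite nnsfun_approxE.
  by rewrite -lee_fin; apply: le_approx => // x _; rewrite lee_fin.
have cvgE : Ex P (fun w => h n w * f w) @[n --> \oo] -->
    Ex P (fun w => Y w * f w).
  apply: (@Ex_dominated _ _ _ _ _ _ (fun w => `|Y w * f w|)).
  - by move=> n; apply: measurable_funM (mh n) (intg_meas mf.1).
  - exact: intg_meas iYf.
  - by move=> w; apply: cvgMl; have /fine_cvgP[] := hY w.
  - exact: integrable_norm.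
  - by move=> n w; rewrite !normrM ler_wpM2r// !ger0_norm.
apply/esym/(cvg_unique _ _ cvgE) => //.
rewrite (_ : (fun _ => _) = cst 0); first exact: cvg_cst.
by apply/funext => n; exact: cond_mean0_nnsfun.
Qed.

(** Taking out what is known: on simple functions by linearity, then for
    nonnegative Y by dominated convergence along simple functions increasing to
    Y, with the bound |Y f|, then for the two signed parts of Y. *)
Lemma pull_out G f Y : sigma_algebra setT G -> G `<=` measurable ->
  cond_mean0 G f -> measurable_wrt G Y ->
  intg P (fun w => Y w * f w) -> Ex P (fun w => Y w * f w) = 0.
Proof.
move=> sG Gm mf mY iYf.
pose Yp w := Num.max (Y w) 0; pose Yn w := Num.max (- Y w) 0.
have mYp : measurable_wrt G Yp by exact: measurable_maxr.
have mYn : measurable_wrt G Yn.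
  by apply: measurable_maxr => //; exact: measurableT_comp.
have le_p w : `|Yp w * f w| <= `|Y w * f w|.
  rewrite !normrM ler_wpM2r// /Yp.
  by have [_|_] := leP (Y w) 0; rewrite ?normr0.
have le_n w : `|Yn w * f w| <= `|Y w * f w|.
  rewrite !normrM ler_wpM2r// /Yn -(normrN (Y w)).
  by have [_|_] := leP (- Y w) 0; rewrite ?normr0.
have mf' := intg_meas mf.1.
have ip : intg P (fun w => Yp w * f w).
  apply: intg_le le_p iYf; apply: measurable_funM => //.
  exact: measurable_wrt_meas mYp.
have inn : intg P (fun w => Yn w * f w).
  apply: intg_le le_n iYf; apply: measurable_funM => //.
  exact: measurable_wrt_meas mYn.
transitivity (Ex P (fun w => Yp w * f w - Yn w * f w)).
  apply: eq_Ex => w; rewrite -mulrBl; congr (_ * _); rewrite /Yp /Yn.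
  by have [?|?] := leP (Y w) 0; have [?|?] := leP (- Y w) 0; lra.
by rewrite ExB// !(pull_out_ge0 sG Gm mf)// ?subr0// => w;
  rewrite /Yp /Yn le_max lexx orbT.
Qed.

End conditional.

(** * Moments of centred Gaussian variables *)

Section normal_law.
Context {R : realType}.
Local Notation lambda := (@lebesgue_measure R).
Implicit Type s : R.

Import HBNNSimple.

Lemma ge0_integral_normal_prob m s (f : measurableTypeR R -> \bar R) :
  measurable_fun setT f -> (forall x, 0 <= f x)%E ->
  (\int[normal_prob m s]_x f x =
   \int[lambda]_x (f x * (normal_pdf m s x)%:E))%E.
Proof.
move=> mf f0; pose q := normal_pdf m s.
have mq : measurable_fun [set: R] (EFin \o q).
  by apply/measurable_EFinP; exact: measurable_normal_pdf.
have q0 x : (0 <= (q x)%:E)%E by rewrite lee_fin normal_pdf_ge0.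
pose f_ := nnsfun_approx measurableT mf.
have nnE n : (\int[normal_prob m s]_x (f_ n x)%:E =
    \int[lambda]_x ((f_ n x)%:E * (q x)%:E))%E.
  under [LHS]eq_integral do rewrite fimfunE -fsumEFin//.
  rewrite [LHS]ge0_integral_fsum//; last 2 first.
  - by move=> r; exact/measurable_EFinP/measurableT_comp.
  - by move=> r x _; rewrite EFinM nnfun_muleindic_ge0.
  under [RHS]eq_integral.
    move=> x _; rewrite fimfunE -fsumEFin// ge0_mule_fsuml; last first.
      by move=> r; rewrite EFinM nnfun_muleindic_ge0.
    over.
  rewrite [RHS]ge0_integral_fsum//; last 2 first.
  - move=> r; apply: emeasurable_funM => //.
    exact/measurable_EFinP/measurableT_comp.
  - move=> r x _; rewrite mule_ge0//.
    by rewrite EFinM nnfun_muleindic_ge0.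
  apply: eq_fsbigr => r _.
  rewrite integralZl_indic_nnsfun// integral_indic// setIT.
  have [r0|r0] := ltP r 0.
    rewrite preimage_nnfun0// measure0 mule0 integral0_eq// => x _.
    by rewrite indicE in_set0 mulr0 mul0e.
  under eq_integral do rewrite EFinM -muleA.
  rewrite ge0_integralZl//; last 2 first.
  - by apply: emeasurable_funM => //; exact/measurable_EFinP.
  - by move=> x _; rewrite mule_ge0// lee_fin.
  congr (_ * _)%E; rewrite [LHS]integral_mkcond.
  apply: eq_integral => x _; rewrite patchE indicE.
  by case: ifP; rewrite ?mul1e ?mul0e.
transitivity (lim (\int[normal_prob m s]_x (f_ n x)%:E @[n --> \oo])%E).
  rewrite -monotone_convergence//=.
  - apply: eq_integral => ? /[!inE] xD; apply/esym/cvg_lim => //=.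
    exact: cvg_nnsfun_approx.
  - by move=> n; exact/measurable_EFinP/measurable_funTS.
  - by move=> n ? _; rewrite lee_fin.
  - by move=> ? _ ? ? mn; rewrite lee_fin; exact/lefP/nd_nnsfun_approx.
under eq_fun do rewrite nnE.
rewrite -monotone_convergence//=.
- apply: eq_integral => x _; apply/cvg_lim => //=.
  by apply: cvgeZr => //; exact: cvg_nnsfun_approx.
- move=> n; apply: emeasurable_funM => //.
  exact/measurable_EFinP/measurable_funTS.
- by move=> n x _; rewrite mule_ge0// lee_fin.
- move=> x _ k l kl; rewrite lee_wpmul2r// lee_fin.
  exact/lefP/nd_nnsfun_approx.
Qed.

Lemma normal_peak2 s : normal_peak s = 2 * normal_peak (2 * s).
Proof.
rewrite /normal_peak (_ : (2 * s) ^+ 2 * pi *+ 2 = 2 ^+ 2 * (s ^+ 2 * pi *+ 2)).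
  by rewrite sqrtrM// sqrtr_sqr ger0_norm// invfM mulVKf.
by ring.
Qed.

(** The Gaussian factor absorbs the square at the price of doubling the
    standard deviation, which bounds the second moment without computing it. *)
Lemma sqr_normal_pdf_le s x : 0 < s ->
  x ^+ 2 * normal_pdf 0 s x <= (6 * s ^+ 2) * normal_pdf 0 (2 * s) x.
Proof.
move=> s0; have s20 : 0 < 2 * s by rewrite mulr_gt0.
rewrite !normal_pdfE ?gt_eqF// (normal_peak2 s).
have pk := normal_peak_ge0 (2 * s).
rewrite [leLHS](_ : _ = normal_peak (2 * s) *
  (2 * (x ^+ 2 * normal_fun 0 s x))); last by ring.
rewrite [leRHS]mulrCA ler_wpM2l//.
rewrite /normal_fun !subr0.
set u := 3 / 8 * (x ^+ 2 / s ^+ 2).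
have s2 : s ^+ 2 != 0 by rewrite sqrf_eq0 gt_eqF.
have -> : - x ^+ 2 / (s ^+ 2 *+ 2) = - x ^+ 2 / ((2 * s) ^+ 2 *+ 2) - u.
  by rewrite /u; field; rewrite gt_eqF.
rewrite expRD [leLHS](_ : _ = (2 * x ^+ 2 * expR (- u)) *
  expR (- x ^+ 2 / ((2 * s) ^+ 2 *+ 2))); last by ring.
rewrite ler_wpM2r ?expR_ge0//.
have xu : x ^+ 2 = 8 / 3 * s ^+ 2 * u by rewrite /u; field; rewrite gt_eqF.
rewrite xu; move: u {xu} => u.
have ue1 : u * expR (- u) <= 1.
  rewrite expRN ler_pdivrMr ?expR_gt0// mul1r.
  by apply: le_trans (expR_ge1Dx u); rewrite lerDr.
have s2_ge0 : 0 <= s ^+ 2 by exact: sqr_ge0.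
rewrite [leLHS](_ : _ = 16 / 3 * s ^+ 2 * (u * expR (- u))); last by ring.
move: (u * expR (- u)) (s ^+ 2) ue1 s2_ge0 => e1 s1; nra.
Qed.

Section gaussian_variable.
Context {d : measure_display} {T : measurableType d} (P : probability T R).
Variables (s : R) (V : T -> R).
Hypotheses (s0 : 0 < s) (mV : measurable_fun setT V)
  (lawV : forall B, measurable B -> P (V @^-1` B) = normal_prob 0 s B).

Lemma ge0_integral_gaussian (f : measurableTypeR R -> \bar R) :
  measurable_fun setT f -> (forall x, 0 <= f x)%E ->
  (\int[P]_w f (V w) = \int[lambda]_x (f x * (normal_pdf 0 s x)%:E))%E.
Proof.
move=> mf f0; rewrite -ge0_integral_normal_prob//.
have mV' : measurable_fun setT (V : T -> measurableTypeR R) by [].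
rewrite -(@ge0_integral_pushforward _ _ _ _ _ _ mV' P setT f)//.
by apply: eq_measure_integral => B mB _; exact: lawV.
Qed.

Lemma gaussian_square_intg :
  (\int[P]_w (V w ^+ 2)%:E <= (6 * s ^+ 2)%:E)%E.
Proof.
rewrite (@ge0_integral_gaussian (fun x => (x ^+ 2)%:E))//; last 2 first.
- by apply/measurable_EFinP; exact: measurable_funX.
- by move=> x; rewrite lee_fin sqr_ge0.
apply: (@le_trans _ _
    (\int[lambda]_x ((6 * s ^+ 2)%:E * (normal_pdf 0 (2 * s) x)%:E))%E).
  apply: ge0_le_integral => //.
  - by move=> x _; rewrite mule_ge0// lee_fin ?sqr_ge0 ?normal_pdf_ge0.
  - apply: emeasurable_funM; apply/measurable_EFinP.
      exact: measurable_funX.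
    exact: measurable_normal_pdf.
  - apply: emeasurable_funM => //; apply/measurable_EFinP.
    exact: measurable_normal_pdf.
  - by move=> x _; rewrite -!EFinM lee_fin sqr_normal_pdf_le.
rewrite ge0_integralZl ?integral_normal_pdf ?mule1//.
- by apply/measurable_EFinP; exact: measurable_normal_pdf.
- by move=> x _; rewrite lee_fin normal_pdf_ge0.
- by rewrite lee_fin mulr_ge0 ?sqr_ge0.
Qed.

Lemma gaussian_square : square_intg P V.
Proof.
split=> //; apply/integrableP; split.
  by apply/measurable_EFinP; exact: measurable_funX.
under eq_integral do rewrite /= ger0_norm ?sqr_ge0//.
exact: le_lt_trans gaussian_square_intg (ltry _).
Qed.

Lemma gaussian_var : Ex P (fun w => V w ^+ 2) <= 6 * s ^+ 2.
Proof.
by rewrite -lee_fin -Ex_EFin ?gaussian_square_intg//; case: gaussian_square.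
Qed.

(** The density is even, so positive and negative parts have the same mean. *)
Lemma gaussian_mean : Ex P V = 0.
Proof.
pose Vp w := Num.max (V w) 0; pose Vn w := Num.max (- V w) 0.
have iV := square_intg_intg gaussian_square.
have ip : intg P Vp.
  apply: intg_le iV => [|w]; first exact: measurable_maxr.
  by rewrite /Vp; have [_|_] := leP (V w) 0; rewrite ?normr0.
have inn : intg P Vn.
  apply: intg_le iV => [|w].
    by apply: measurable_maxr => //; exact: measurableT_comp.
  by rewrite /Vn -(normrN (V w)); have [_|_] := leP (- V w) 0; rewrite ?normr0.
have -> : Ex P V = Ex P (fun w => Vp w - Vn w).
  apply: eq_Ex => w; rewrite /Vp /Vn.
  by have [?|?] := leP (V w) 0; have [?|?] := leP (- V w) 0; lra.
rewrite ExB//; apply/eqP; rewrite subr_eq0; apply/eqP/EFin_inj.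
rewrite -!Ex_EFin// /Vp /Vn.
pose f := fun x : measurableTypeR R => (Num.max x 0)%:E.
pose q := fun x : measurableTypeR R => (f x * (normal_pdf 0 s x)%:E)%E.
have mf : measurable_fun setT f.
  by apply/measurable_EFinP; exact: measurable_maxr.
have mN : measurable_fun setT (-%R : measurableTypeR R -> measurableTypeR R).
  exact: oppr_measurable.
have f0 x : (0 <= f x)%E by rewrite lee_fin le_max lexx orbT.
rewrite (ge0_integral_gaussian mf f0).
rewrite (@ge0_integral_gaussian (fun x => f (- x)%R))//; last first.
  exact: (measurableT_comp mf mN).
have -> : (\int[lambda]_x (f (- x)%R * (normal_pdf 0 s x)%:E) =
    \int[lambda]_x (q \o (-%R : measurableTypeR R -> measurableTypeR R)) x)%E.
  apply: eq_integral => x _; rewrite /q/= !normal_pdfE ?gt_eqF//.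
  by rewrite /normal_fun !subr0 sqrrN.
rewrite -(@ge0_integral_pushforward _ _ _ _ _ _ mN lambda setT q)//.
- by apply: eq_measure_integral => B mB _; exact/esym/lebesgue_measureN.
- apply: emeasurable_funM => //; apply/measurable_EFinP.
  exact: measurable_normal_pdf.
- by move=> x _; rewrite mule_ge0// lee_fin normal_pdf_ge0.
Qed.

End gaussian_variable.

End normal_law.

(** * Independence *)

Section measurable_wrt_ops.
Context {d : measure_display} {T : measurableType d} {R : realType}.
Implicit Types (f g : T -> R) (G : set (set T)).

Lemma measurable_wrt_cst G k : measurable_wrt G (fun _ : T => k : R).
Proof. exact: measurable_cst. Qed.

Lemma measurable_wrtM G f g : measurable_wrt G f -> measurable_wrt G g ->
  measurable_wrt G (fun w => f w * g w).
Proof. exact: measurable_funM. Qed.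

Lemma measurable_wrtD G f g : measurable_wrt G f -> measurable_wrt G g ->
  measurable_wrt G (fun w => f w + g w).
Proof. exact: measurable_funD. Qed.

Lemma measurable_wrtB G f g : measurable_wrt G f -> measurable_wrt G g ->
  measurable_wrt G (fun w => f w - g w).
Proof. exact: measurable_funB. Qed.

Lemma measurable_wrtX G f n : measurable_wrt G f ->
  measurable_wrt G (fun w => f w ^+ n).
Proof. exact: measurable_funX. Qed.

End measurable_wrt_ops.

Section independence.
Context {d : measure_display} {T : measurableType d} {R : realType}.
Variable P : probability T R.

(** Apply [pull_out] to the sigma-algebra generated by [V], with respect to
    which the centred indicator of an event independent of [V] has zero
    conditional mean; this trades the approximation of [h \o V] for that of an
    indicator. *)
Lemma independent_cond_mean0 (G : set (set T)) (V : T -> R) (h : R -> R) :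
  G `<=` measurable ->
  measurable_fun setT V ->
  (forall A B, G A -> measurable B ->
    P (A `&` V @^-1` B) = (P A * P (V @^-1` B))%E) ->
  measurable_fun setT h -> intg P (h \o V) ->
  cond_mean0 P G (fun w => h (V w) - Ex P (h \o V)).
Proof.
move=> Gm mV indep mh hi; set c := Ex P _.
split=> [|A GA]; first exact: intgB hi (intg_cst _ _).
have mA := Gm _ GA; set p := Ex P \1_A.
have bA : bounded_rv (\1_A : T -> R) := bounded_rv_indic mA.
pose G' := preimage_set_system setT V measurable.
have mpre B : measurable B -> measurable (V @^-1` B).
  by move=> mB; rewrite -[_ @^-1` _]setTI; exact: mV.
have G'm : G' `<=` measurable by move=> _ [B mB <-]; exact: mV.
have cm : cond_mean0 P G' (fun w => \1_A w - p).
  split=> [|_ [B mB <-]].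
    by apply: intgB; [exact: bounded_intg|exact: intg_cst].
  rewrite setTI; have bB := bounded_rv_indic (mpre _ mB).
  transitivity (Ex P (fun w => \1_(A `&` V @^-1` B) w - p * \1_(V @^-1` B) w)).
    by apply: eq_Ex => w; rewrite indicI/=; ring.
  rewrite ExB; last 2 first.
  - apply/bounded_intg/bounded_rv_indic; apply: measurableI => //.
    exact: mpre.
  - exact/intgZ/bounded_intg.
  rewrite ExZ; last exact: bounded_intg.
  apply/eqP; rewrite subr_eq0; apply/eqP/EFin_inj.
  rewrite EFinM !Ex_indic//; first exact: indep.
  - exact: mpre.
  - by apply: measurableI => //; exact: mpre.
have iY : intg P (fun w => h (V w) * (\1_A w - p)).
  under eq_fun do rewrite mulrC.
  by apply: intgM_bounded => //; apply: bounded_rvD => //; exact: bounded_cst.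
have mY : measurable_wrt G' (h \o V).
  move=> _ B mB; rewrite setTI comp_preimage.
  apply: sub_sigma_algebra; exists (h @^-1` B); last by rewrite setTI.
  by rewrite -[_ @^-1` _]setTI; exact: mh.
have sG' : sigma_algebra setT G'.
  by apply: sigma_algebra_preimage; exact: sigma_algebra_measurable.
have pull := pull_out sG' G'm cm mY iY.
have iA : intg P (fun w => \1_A w * h (V w)) by exact: intgM_bounded.
rewrite -[RHS]pull.
transitivity (Ex P (fun w => \1_A w * h (V w)) - c * p).
  rewrite -ExZ; last exact: bounded_intg.
  rewrite -ExB//; last exact/intgZ/bounded_intg.
  by apply: eq_Ex => w; ring.
rewrite mulrC -(ExZ _ hi) -ExB//; last exact: intgZ.
by apply: eq_Ex => w /=; ring.
Qed.

End independence.

(** * Elementary stochastic integrals *)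

Section brownian.
Context {d : measure_display} {T : measurableType d} {R : realType}.
Variables (P : probability T R) (F : R -> set (set T)) (W : R -> T -> R).
Hypotheses (hF : filtration F) (hW : brownian_motion P F W).
Implicit Types (s t : R) (xi Y G : T -> R).

Lemma filtration_sigma t : 0 <= t -> sigma_algebra setT (F t).
Proof. by case: hF => h _ _; exact: h. Qed.

Lemma filtration_meas t : 0 <= t -> F t `<=` measurable.
Proof. by case: hF => _ h _; exact: h. Qed.

Lemma filtration_le s t : 0 <= s -> s <= t -> F s `<=` F t.
Proof. by case: hF => _ _; apply. Qed.

Lemma adapted_le (X : R -> T -> R) s t : adapted F X -> 0 <= s -> s <= t ->
  measurable_wrt (F t) (X s).
Proof.
by move=> aX s0 st; apply: measurable_wrt_sub (aX _ s0); exact: filtration_le.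
Qed.

Lemma brownian_increment s t : 0 <= s -> s < t ->
  [/\ square_intg P (increment W s t),
      cond_mean0 P (F s) (increment W s t)
    & exists2 c, 0 <= c <= 6 * (t - s) &
        cond_mean0 P (F s) (fun w => increment W s t w ^+ 2 - c)].
Proof.
move=> s0 st; have [aW _ _ lawW indW] := hW.
have t0 : 0 <= t := le_trans s0 (ltW st).
have mV : measurable_fun setT (increment W s t).
  apply: (measurable_wrt_meas (filtration_meas t0)).
  by apply: measurable_wrtB; apply: adapted_le => //; exact: ltW.
have ts0 : 0 < Num.sqrt (t - s) by rewrite sqrtr_gt0 subr_gt0.
have lawV := lawW _ _ s0 st.
have ind A B (FA : F s A) (mB : measurable B) := indW _ _ s0 st A B FA mB.
have sqV := gaussian_square ts0 mV lawV.
have iV := square_intg_intg sqV.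
have iV2 := sqV.2.
split => //.
- have := independent_cond_mean0 (filtration_meas s0) mV ind
    (@measurable_id _ R setT) iV.
  rewrite (_ : Ex P (idfun \o _) = 0); last exact: gaussian_mean lawV.
  by under eq_fun do rewrite subr0.
- exists (Ex P (fun w => increment W s t w ^+ 2)).
    rewrite Ex_ge0/=; last by move=> w; exact: sqr_ge0.
    have := gaussian_var ts0 mV lawV.
    by rewrite sqr_sqrtr// subr_ge0 ltW.
  exact: (independent_cond_mean0 (h := fun x => x ^+ 2) (filtration_meas s0) mV
    ind (measurable_funX 2 (@measurable_id _ R setT)) iV2).
Qed.

(** The elementary stochastic integral of one block [xi 1_(]s, t])]. The case
    [s = t], where [xi] need not be known at time [s], covers the blocks of a
    simple process that fall outside the interval of integration. *)
Lemma brownian_block s t xi : 0 <= s -> s <= t -> bounded_rv xi ->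
  (s < t -> measurable_wrt (F s) xi) ->
  let X w := xi w * (W t w - W s w) in
  [/\ square_intg P X, measurable_wrt (F t) X,
      forall Y, measurable_wrt (F s) Y -> square_intg P Y ->
        Ex P (fun w => Y w * X w) = 0
    & forall G, measurable_wrt (F s) G -> bounded_rv G ->
        (forall w, 0 <= G w) ->
        Ex P (fun w => G w * X w ^+ 2) <=
        6 * Ex P (fun w => G w * (xi w ^+ 2 * (t - s)))].
Proof.
move=> s0; rewrite le_eqVlt => /predU1P[<- bxi _ X|st bxi /(_ st) mxi X].
  have -> : X = fun=> 0 by apply/funext => w; rewrite /X subrr mulr0.
  have E0 Y : Ex P (fun w => Y w * 0) = 0.
    by under eq_Ex do rewrite mulr0; exact: Ex_cst.
  split => //.
  - exact: bounded_square (bounded_cst 0).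
  - exact: measurable_wrt_cst.
  - move=> G _ _ _.
    under eq_Ex do rewrite expr0n/=.
    under [X in _ <= _ * X]eq_Ex do rewrite subrr mulr0.
    by rewrite !E0 mulr0.
have t0 : 0 <= t := le_trans s0 (ltW st).
have [sqV cV [c /andP[c0 cts] cV2]] := brownian_increment s0 st.
have sigF := filtration_sigma s0; have Fm := filtration_meas s0.
have aW : adapted F W by case: hW.
split.
- exact: squareM_bounded.
- apply: measurable_wrtM.
    by apply: measurable_wrt_sub mxi; apply: filtration_le => //; exact: ltW.
  by apply: measurable_wrtB; apply: adapted_le => //; exact: ltW.
- move=> Y mY sqY.
  transitivity (Ex P (fun w => (xi w * Y w) * increment W s t w)).
    by apply: eq_Ex => w; rewrite /X mulrCA mulrA.
  apply: (pull_out sigF Fm cV); first exact: measurable_wrtM.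
  by apply: squareM => //; exact: squareM_bounded.
- move=> G mG bG G0.
  have bGx : bounded_rv (fun w => G w * xi w ^+ 2).
    by apply: bounded_rvM => //; exact: bounded_rvM.
  have iV2 := sqV.2.
  apply: (@le_trans _ _ (Ex P (fun w => c * (G w * xi w ^+ 2)))); last first.
    rewrite ExZ; last exact: bounded_intg.
    rewrite [X in _ <= _ * X](_ : _ =
        (t - s) * Ex P (fun w => G w * xi w ^+ 2)).
      rewrite mulrA ler_wpM2r//; apply: Ex_ge0 => w.
      by rewrite mulr_ge0// sqr_ge0.
    by rewrite -ExZ; [apply: eq_Ex => w; ring|exact: bounded_intg].
  have /eqP : Ex P (fun w => (G w * xi w ^+ 2) *
      (increment W s t w ^+ 2 - c)) = 0.
    apply: (pull_out sigF Fm cV2).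
      by apply: measurable_wrtM => //; exact: measurable_wrtX.
    by apply: intgM_bounded => //; exact: cV2.1.
  rewrite (@eq_Ex _ _ _ P _
      (fun w => G w * X w ^+ 2 - c * (G w * xi w ^+ 2))).
    rewrite ExB ?subr_eq0.
    + by move=> /eqP ->.
    + rewrite (_ : (fun _ => _) =
        fun w => (G w * xi w ^+ 2) * increment W s t w ^+ 2).
        exact: intgM_bounded.
      by apply/funext => w; rewrite /X exprMn mulrA.
    + exact/intgZ/bounded_intg.
  by move=> w; rewrite /X /increment; ring.
Qed.

End brownian.

Section brownian_sums.
Context {d : measure_display} {T : measurableType d} {R : realType}.
Variables (P : probability T R) (F : R -> set (set T)) (W : R -> T -> R).
Hypotheses (hF : filtration F) (hW : brownian_motion P F W).
Implicit Types (c : nat -> R) (xi : nat -> T -> R).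

Definition brownian_sum c xi n w : R :=
  \sum_(i < n) xi i w * (W (c i.+1) w - W (c i) w).

Definition bracket_sum c xi n w : R :=
  \sum_(i < n) xi i w ^+ 2 * (c i.+1 - c i).

(** Blocks of zero length may carry a coefficient that is not measurable at
    their left end: these arise when a simple process is cut to [s, t]. *)
Definition predictable_blocks c xi n := 0 <= c 0%N /\ forall i, (i < n)%N ->
  [/\ c i <= c i.+1, bounded_rv (xi i)
    & c i < c i.+1 -> measurable_wrt (F (c i)) (xi i)].

Lemma predictable_blocksS c xi n :
  predictable_blocks c xi n.+1 -> predictable_blocks c xi n.
Proof. by move=> [c0 H]; split=> // i /ltnW; exact: H. Qed.

Lemma predictable_blocks_le c xi n : predictable_blocks c xi n -> c 0%N <= c n.
Proof.
elim: n => // n IH [c0 H].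
have [cn _ _] := H n (ltnSn n).
by apply: le_trans cn; apply: IH; exact: (@predictable_blocksS c xi n).
Qed.

Lemma bracket_sum_bounded c xi n : predictable_blocks c xi n ->
  bounded_rv (bracket_sum c xi n).
Proof.
elim: n => [|n IH] H.
  rewrite (_ : bracket_sum c xi 0 = fun=> 0); first exact: bounded_cst.
  by apply/funext => w; rewrite /bracket_sum big_ord0.
rewrite (_ : bracket_sum c xi n.+1 = fun w =>
    bracket_sum c xi n w + xi n w ^+ 2 * (c n.+1 - c n)); last first.
  by apply/funext => w; rewrite /bracket_sum big_ord_recr.
apply: bounded_rvD; first exact/IH/predictable_blocksS.
have [_ b _] := H.2 n (ltnSn n).
by apply: bounded_rvM; [exact: bounded_rvM|exact: bounded_cst].
Qed.

(** The weighted Itô isometry, as an inequality. New blocks are orthogonal to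
    everything known before them, so neither the mean nor the second moment sees
    cross terms; the weight G, known at the start, goes along. *)
Lemma brownian_sumP c xi n : predictable_blocks c xi n ->
  [/\ square_intg P (brownian_sum c xi n),
      measurable_wrt (F (c n)) (brownian_sum c xi n),
      forall Y, measurable_wrt (F (c 0%N)) Y -> square_intg P Y ->
        Ex P (fun w => Y w * brownian_sum c xi n w) = 0
    & forall G, measurable_wrt (F (c 0%N)) G -> bounded_rv G ->
        (forall w, 0 <= G w) ->
        Ex P (fun w => G w * brownian_sum c xi n w ^+ 2) <=
        6 * Ex P (fun w => G w * bracket_sum c xi n w)].
Proof.
elim: n => [|n IH] H.
  have -> : brownian_sum c xi 0 = fun=> 0.
    by apply/funext => w; rewrite /brownian_sum big_ord0.
  split.
  - exact/bounded_square/bounded_cst.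
  - exact: measurable_wrt_cst.
  - by move=> Y _ _; under eq_Ex do rewrite mulr0; exact: Ex_cst.
  - move=> G _ _ G0; under eq_Ex do rewrite expr0n/= mulr0; rewrite Ex_cst.
    rewrite mulr_ge0// Ex_ge0// => w.
    by rewrite mulr_ge0// /bracket_sum big_ord0.
have H' := predictable_blocksS H; have [sqA mA oA vA] := IH H'.
have c0n := predictable_blocks_le H'; have c0 := H.1.
have [cn bn mn] := H.2 n (ltnSn n).
have cn0 : 0 <= c n := le_trans c0 c0n.
have [sqX mX oX vX] := brownian_block hF hW cn0 cn bn mn.
set X := (X in square_intg P X) in sqX mX oX vX.
have bsE w : brownian_sum c xi n.+1 w = brownian_sum c xi n w + X w.
  by rewrite /brownian_sum big_ord_recr.
have F0n : F (c 0%N) `<=` F (c n) by exact: filtration_le.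
have lift G : measurable_wrt (F (c 0%N)) G -> measurable_wrt (F (c n)) G.
  exact: measurable_wrt_sub.
rewrite (_ : brownian_sum c xi n.+1 = fun w => brownian_sum c xi n w + X w);
  last exact/funext.
split.
- exact: squareD.
- apply: measurable_wrtD => //; apply: measurable_wrt_sub mA.
  exact: filtration_le.
- move=> Y mY sqY.
  under eq_Ex do rewrite mulrDr.
  rewrite ExD; [|exact: squareM..].
  by rewrite oA// oX ?addr0//; exact: lift.
- move=> G mG bG G0.
  have iA2 : intg P (fun w => G w * brownian_sum c xi n w ^+ 2).
    by apply: intgM_bounded => //; exact: sqA.2.
  have iX2 : intg P (fun w => G w * X w ^+ 2).
    by apply: intgM_bounded => //; exact: sqX.2.
  have sqGA : square_intg P (fun w => G w * brownian_sum c xi n w).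
    exact: squareM_bounded.
  have iAX : intg P (fun w => (G w * brownian_sum c xi n w) * X w).
    exact: squareM.
  have oAX : Ex P (fun w => (G w * brownian_sum c xi n w) * X w) = 0.
    by apply: oX => //; apply: measurable_wrtM => //; exact: lift.
  have -> : Ex P (fun w => G w * (brownian_sum c xi n w + X w) ^+ 2) =
      Ex P (fun w => G w * brownian_sum c xi n w ^+ 2) +
      Ex P (fun w => G w * X w ^+ 2).
    transitivity (Ex P (fun w => (G w * brownian_sum c xi n w ^+ 2 +
        2 * (G w * brownian_sum c xi n w * X w)) + G w * X w ^+ 2)).
      by apply: eq_Ex => w; ring.
    rewrite ExD//; last by apply: intgD => //; exact: intgZ.
    by rewrite ExD//; [rewrite ExZ// oAX mulr0 addr0|exact: intgZ].
  have bB : bounded_rv (fun w => xi n w ^+ 2 * (c n.+1 - c n)).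
    by apply: bounded_rvM; [exact: bounded_rvM|exact: bounded_cst].
  have -> : Ex P (fun w => G w * bracket_sum c xi n.+1 w) =
      Ex P (fun w => G w * bracket_sum c xi n w) +
      Ex P (fun w => G w * (xi n w ^+ 2 * (c n.+1 - c n))).
    rewrite -ExD; last 2 first.
    + apply: bounded_intg; apply: bounded_rvM => //.
      exact: bracket_sum_bounded.
    + by apply: bounded_intg; exact: bounded_rvM.
    by apply: eq_Ex => w; rewrite /bracket_sum big_ord_recr/= mulrDr.
  rewrite mulrDr lerD//; first exact: vA.
  by apply: vX => //; exact: lift.
Qed.

End brownian_sums.

(** * Simple processes along a path *)

Section nonmeasurable_monotonicity.
Context {d : measure_display} {T : measurableType d} {R : realType}.
Variable mu : {measure set T -> \bar R}.

(** The integral of a nonnegative function is a supremum over the simple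
    functions below it. This form serves to bound from below the double integral
    of (H - S)^2, whose inner integral is not known to depend measurably on the
    path. *)
Lemma ge0_le_integral_any (D : set T) (f g : T -> \bar R) :
  (forall x, D x -> 0 <= f x)%E -> (forall x, D x -> f x <= g x)%E ->
  (\int[mu]_(x in D) f x <= \int[mu]_(x in D) g x)%E.
Proof.
move=> f0 fg; have g0 x : D x -> (0 <= g x)%E.
  by move=> Dx; exact: le_trans (f0 _ Dx) (fg _ Dx).
rewrite !ge0_integralE//; apply: le_ereal_sup => _ [h hf <-] /=.
exists h => // x; apply: le_trans (hf x) _.
by rewrite !patchE; case: ifPn => // /set_mem; exact: fg.
Qed.

End nonmeasurable_monotonicity.

Section simple_paths.
Context {R : realType}.
Local Notation lambda := (@lebesgue_measure R).
Implicit Types (s t u x y : R) (c tm : nat -> R).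

Definition clamp s t x : R := Num.max s (Num.min x t).

Lemma clamp_ge s t x : s <= clamp s t x.
Proof. by rewrite /clamp le_max lexx. Qed.

Lemma clamp_le s t x : s <= t -> clamp s t x <= t.
Proof. by move=> st; rewrite /clamp ge_max st ge_min lexx orbT. Qed.

Lemma clamp_mono s t x y : x <= y -> clamp s t x <= clamp s t y.
Proof. by move=> xy; rewrite /clamp le_max2// le_min2. Qed.

Lemma clamp_lt_le s t x y : s <= t -> x <= y -> clamp s t x < clamp s t y ->
  x <= clamp s t x.
Proof.
move=> st xy; rewrite /clamp; have [xt|tx] := leP x t.
  by rewrite le_max lexx orbT.
by rewrite min_r ?ltxx// (le_trans (ltW tx)).
Qed.

Lemma clamp_indic s t x y u : s < u -> u <= t ->
  \1_(`]x, y]%classic) u = \1_(`]clamp s t x, clamp s t y]%classic) u :> R.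
Proof.
move=> su ut; rewrite !indicE !mem_setE !in_itv/= /clamp.
rewrite gt_max su/= gt_min le_max le_min ut andbT.
by rewrite (leNgt u s) su/= (ltNge t u) ut orbF.
Qed.

Lemma clamp_increment (f : R -> R) s t x y : s <= t ->
  (f (Num.min y t) - f (Num.min x t)) - (f (Num.min y s) - f (Num.min x s)) =
  f (clamp s t y) - f (clamp s t x).
Proof.
move=> st.
have key u : f (Num.min u t) - f (Num.min u s) = f (clamp s t u) - f s.
  rewrite /clamp; have [us|su] := leP u s.
    by rewrite min_l ?(le_trans us)// max_l// !subrr.
  by rewrite max_r// le_min (ltW su).
by have := key x; have := key y; lra.
Qed.

Lemma nondecreasing_upto tm n : (forall i, (i < n)%N -> tm i <= tm i.+1) ->
  forall i j, (i <= j)%N -> (j <= n)%N -> tm i <= tm j.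
Proof.
move=> mono i; elim=> [|j IH]; first by rewrite leqn0 => /eqP ->.
rewrite leq_eqVlt => /predU1P[->//|]; rewrite ltnS => ij jn.
by apply: le_trans (mono j jn); apply: IH => //; exact: ltnW.
Qed.

(** At most one of the intervals of a nondecreasing subdivision contains a given
    point, so cross terms vanish. *)
Lemma sqr_step_sum tm (x : nat -> R) n u :
  (forall i, (i < n)%N -> tm i <= tm i.+1) ->
  (\sum_(i < n) x i * \1_(`]tm i, tm i.+1]%classic) u) ^+ 2 =
  \sum_(i < n) x i ^+ 2 * \1_(`]tm i, tm i.+1]%classic) u.
Proof.
elim: n => [|n IH] mono; first by rewrite !big_ord0 expr0n.
have mono' i : (i < n)%N -> tm i <= tm i.+1 by move/ltnW; exact: mono.
rewrite !big_ord_recr/=; have [ui|ui] := boolP (u \in `]tm n, tm n.+1]).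
  have out (i : 'I_n) : \1_(`]tm i, tm i.+1]%classic) u = 0 :> R.
    have tin : tm i.+1 <= tm n by apply: nondecreasing_upto mono' _ _ _ _.
    rewrite indicE mem_setE in_itv/=; move: ui; rewrite in_itv/= => /andP[nu _].
    by rewrite (leNgt u) (le_lt_trans tin nu) andbF.
  rewrite !big1 ?add0r; [|by move=> i _; rewrite out mulr0..].
  by rewrite exprMn indicE mem_setE ui expr1n.
by rewrite indicE mem_setE (negbTE ui) !mulr0 !addr0 IH.
Qed.

(** The elementary bound (H - S)^2 >= S^2 / 2 - H^2, integrated over ]s, t]; the
    square of the step function S is integrated exactly. *)
Lemma bracket_le_integral (H : R -> R) s t tm (x : nat -> R) n M :
  0 <= s -> s <= t -> (forall i, (i < n)%N -> tm i <= tm i.+1) ->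
  (forall u, 0 <= u <= t -> `|H u| <= M) ->
  (((\sum_(i < n) x i ^+ 2 * (clamp s t (tm i.+1) - clamp s t (tm i))) / 2
     - M ^+ 2 * (t - s))%:E <=
   \int[lambda]_(u in `[0%R, t])
     ((H u - \sum_(i < n) x i * \1_(`]tm i, tm i.+1]%classic) u) ^+ 2)%:E)%E.
Proof.
move=> s0 st mono HM.
pose c i := clamp s t (tm i).
pose q u : R := \sum_(i < n) x i ^+ 2 * \1_(`]c i, c i.+1]%classic) u.
pose I u : R := \1_(`]s, t]%classic) u.
pose f u := Num.max (q u / 2 - M ^+ 2 * I u) 0.
have cmono i : (i < n)%N -> c i <= c i.+1 by move=> /mono; exact: clamp_mono.
have q0 u : 0 <= q u by apply: sumr_ge0 => i _; rewrite mulr_ge0// sqr_ge0.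
have I0 u : 0 <= I u by [].
have mq : measurable_fun setT q.
  by apply: measurable_sum => i; apply: measurable_funM => //.
have mI : measurable_fun setT I by exact: measurable_indic.
have f0 u : 0 <= f u by rewrite le_max lexx orbT.
have mf : measurable_fun setT f.
  apply: measurable_maxr => //; apply: measurable_funB.
    exact: measurable_funM.
  exact: measurable_funM.
have sub_st : `]s, t]%classic `<=` `[0, t]%classic.
  move=> u; rewrite /= !in_itv/= => /andP[/ltW su ->].
  by rewrite (le_trans s0 su).
have intI : (\int[lambda]_(u in `[0%R, t]) (I u)%:E = (t - s)%:E)%E.
  rewrite integral_indic//= setIidl// lebesgue_measure_itv/= lte_fin.
  by move: st; rewrite le_eqVlt => /predU1P[->|->]//; rewrite ltxx subrr.
have intq : (\int[lambda]_(u in `[0%R, t]) (q u)%:E =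
    (\sum_(i < n) x i ^+ 2 * (c i.+1 - c i))%:E)%E.
  under eq_integral do rewrite -sumEFin.
  rewrite ge0_integral_sum//; last 2 first.
  - move=> i; apply/measurable_EFinP/measurable_funTS.
    by apply: measurable_funM.
  - by move=> i u _; rewrite lee_fin mulr_ge0// sqr_ge0.
  rewrite -sumEFin; apply: eq_bigr => i _.
  under eq_integral do rewrite EFinM.
  rewrite ge0_integralZl//; last 2 first.
  - exact/measurable_EFinP/measurable_funTS/measurable_indic.
  - by rewrite lee_fin sqr_ge0.
  rewrite integral_indic//= setIidl; last first.
    move=> u; rewrite /= !in_itv/= => /andP[cu uc].
    rewrite (le_trans s0 (le_trans (clamp_ge s t _) (ltW cu)))/=.
    exact: le_trans uc (clamp_le _ st).
  rewrite lebesgue_measure_itv/= lte_fin [RHS]EFinM; congr (_ * _)%E.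
  have := cmono i (ltn_ord i).
  by rewrite le_eqVlt => /predU1P[->|->]//; rewrite ltxx subrr.
have step : (\int[lambda]_(u in `[0%R, t]) (q u / 2)%:E <=
    \int[lambda]_(u in `[0%R, t]) (f u)%:E + (M ^+ 2 * (t - s))%:E)%E.
  rewrite EFinM -intI -ge0_integralZl//; last 3 first.
  - exact/measurable_EFinP/measurable_funTS.
  - by move=> u _; rewrite lee_fin.
  - by rewrite lee_fin sqr_ge0.
  rewrite -ge0_integralD//; last 4 first.
  - by move=> u _; rewrite lee_fin.
  - exact/measurable_EFinP/measurable_funTS.
  - by move=> u _; rewrite mule_ge0// lee_fin ?sqr_ge0 ?I0.
  - apply: emeasurable_funM => //.
    exact/measurable_EFinP/measurable_funTS.
  apply: ge0_le_integral_any => u _; first by rewrite lee_fin mulr_ge0.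
  by rewrite -EFinM -EFinD lee_fin /f -lerBlDr le_max lexx.
apply: (@le_trans _ _ (\int[lambda]_(u in `[0%R, t]) (f u)%:E)%E).
  rewrite EFinB leeBlDr//; apply: le_trans step.
  under [leRHS]eq_integral do rewrite EFinM.
  rewrite ge0_integralZr//.
  - by rewrite intq -EFinM.
  - exact/measurable_EFinP/measurable_funTS.
  - by move=> u _; rewrite lee_fin.
apply: ge0_le_integral_any => u /=; first by rewrite lee_fin.
rewrite in_itv/= => ut; rewrite lee_fin /f ge_max sqr_ge0 andbT.
have [us|su] := leP u s.
  rewrite /I indicE mem_setE in_itv/= ltNge us/= mulr0 subr0.
  rewrite (_ : q u = 0) ?mul0r ?sqr_ge0//.
  rewrite /q big1// => i _; rewrite indicE mem_setE in_itv/= /c.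
  by rewrite ltNge (le_trans us (clamp_ge _ _ _)) mulr0.
rewrite /I indicE mem_setE in_itv/= su (andP ut).2/= mulr1.
have -> : q u = (\sum_(i < n) x i * \1_(`]tm i, tm i.+1]%classic) u) ^+ 2.
  rewrite sqr_step_sum//; apply: eq_bigr => i _.
  by rewrite [in RHS](clamp_indic _ _ su (andP ut).2).
have HM2 : H u ^+ 2 <= M ^+ 2.
  rewrite -real_normK ?num_real// lerXn2r ?nnegrE ?HM//.
  exact: le_trans (HM _ ut).
move: (\sum_(i < n) _) (H u) HM2 => v h HM2.
by have := sqr_ge0 (2 * h - v); move: (M ^+ 2) HM2 => m; nra.
Qed.

End simple_paths.

(** * Conditional variance of the increments of a stochastic integral *)

Section ito_isometry.
Context {d : measure_display} {T : measurableType d} {R : realType}.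
Variables (P : probability T R) (F : R -> set (set T)) (W : R -> T -> R).
Hypotheses (hF : filtration F) (hW : brownian_motion P F W).
Local Notation lambda := (@lebesgue_measure R).
Implicit Types (S : @simple_process d T R).

Lemma Ex_indicM A f : Ex P (fun w => \1_A w * f w) = Rintegral P A f.
Proof.
rewrite Rintegral_mkcond; apply: eq_Rintegral => w _.
by rewrite patchE indicE; case: ifP; rewrite ?mul1r ?mul0r.
Qed.

Lemma martingale_cond_mean0 X s t : martingale P F X -> 0 <= s -> s <= t ->
  cond_mean0 P (F s) (fun w => X t w - X s w).
Proof.
move=> [aX iX mX] s0 st; have t0 := le_trans s0 st.
have iXt : intg P (X t) := iX _ t0; have iXs : intg P (X s) := iX _ s0.
have [_ _ e] := mX _ _ s0 st.
split=> [|A FA]; first exact: intgB.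
have bA : bounded_rv (\1_A : T -> R).
  exact/bounded_rv_indic/(filtration_meas hF s0 FA).
under eq_Ex do rewrite mulrBr.
rewrite ExB ?Ex_indicM; [|exact: intgM_bounded..].
by rewrite /Rintegral e// subrr.
Qed.

Lemma simple_time_ge0 S i : is_simple F S -> (i <= sp_len S)%N ->
  0 <= sp_time S i.
Proof.
move=> [t0 mono _] il; apply: le_trans t0 _.
exact: (nondecreasing_upto mono).
Qed.

Lemma simple_blocks S s t : is_simple F S -> 0 <= s -> s <= t ->
  predictable_blocks F (clamp s t \o sp_time S) (sp_coef S) (sp_len S).
Proof.
move=> hS s0 st; have [_ mono coef] := hS.
split=> [|i il]; first exact: le_trans s0 (clamp_ge _ _ _).
have ti0 := simple_time_ge0 hS (ltnW il).
have [mxi [M [Mr bM]]] := coef i il.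
split.
- exact/clamp_mono/mono.
- split; first by apply: (measurable_wrt_meas _ mxi); exact: filtration_meas.
  exists (M + 1) => w; apply: bM => //; first by rewrite ltrDl.
- move=> lt_c; apply: measurable_wrt_sub mxi; apply: filtration_le => //.
  exact: (clamp_lt_le st (mono _ il) lt_c).
Qed.

Lemma sp_int_increment S s t w : s <= t ->
  sp_int W S t w - sp_int W S s w =
  brownian_sum W (clamp s t \o sp_time S) (sp_coef S) (sp_len S) w.
Proof.
move=> st; rewrite /sp_int /brownian_sum -sumrB; apply: eq_bigr => i _.
by rewrite -mulrBr (clamp_increment (W ^~ w)).
Qed.

Lemma sp_int_brownian_sum S s w : is_simple F S -> 0 <= s ->
  sp_int W S s w =
  brownian_sum W (clamp 0 s \o sp_time S) (sp_coef S) (sp_len S) w.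
Proof.
move=> hS s0; apply: eq_bigr => i _ /=.
rewrite /clamp !max_r// le_min s0 andbT.
- exact: simple_time_ge0 (ltnW (ltn_ord i)).
- exact: simple_time_ge0 (ltn_ord i).
Qed.

Variables (X H : R -> T -> R) (M : R).
Hypotheses (X_mart : martingale P F X)
  (X_square : forall t, 0 <= t -> square_intg P (X t))
  (H_bounded : forall t w, 0 <= t -> `|H t w| <= M).

(** Pythagoras for the martingale X - z - (S . W). The simple processes are
    chosen for the integral over [0, t] alone; orthogonality of increments makes
    them good on [s, t] as well. *)
Lemma increment_error_le S s t z : is_simple F S -> 0 <= s -> s <= t ->
  Ex P (fun w => (X t w - X s w - (sp_int W S t w - sp_int W S s w)) ^+ 2) <=
  Ex P (fun w => (X t w - z - sp_int W S t w) ^+ 2).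
Proof.
move=> hS s0 st; have t0 := le_trans s0 st.
have Hst := simple_blocks hS s0 st; have H0s := simple_blocks hS (lexx 0) s0.
have [sqD _ oD _] := brownian_sumP hF hW Hst.
have [sqI mI _ _] := brownian_sumP hF hW H0s.
have aX : adapted F X by case: X_mart.
pose A w := X s w - z - sp_int W S s w.
pose D w := X t w - X s w - (sp_int W S t w - sp_int W S s w).
have DE : D = fun w => (X t w - X s w) -
    brownian_sum W (clamp s t \o sp_time S) (sp_coef S) (sp_len S) w.
  by apply/funext => w; rewrite /D sp_int_increment.
have IE : sp_int W S s =
    brownian_sum W (clamp 0 s \o sp_time S) (sp_coef S) (sp_len S).
  by apply/funext => w; exact: sp_int_brownian_sum.
have sqz : square_intg P (fun=> z) := bounded_square P (bounded_cst z).
have sqA : square_intg P A.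
  by apply: squareB; [apply: squareB => //; exact: X_square|rewrite IE].
have mA : measurable_wrt (F s) A.
  apply: measurable_wrtB.
    by apply: measurable_wrtB; [exact: aX|exact: measurable_wrt_cst].
  rewrite IE; apply: measurable_wrt_sub mI; apply: filtration_le => //.
    by rewrite (le_trans _ (clamp_ge _ _ _)).
  exact: clamp_le.
have sqX : square_intg P (fun w => X t w - X s w).
  by apply: squareB; exact: X_square.
have sqDD : square_intg P D by rewrite DE; exact: squareB.
have oAD : Ex P (fun w => A w * D w) = 0.
  rewrite DE; under eq_Ex do rewrite mulrBr.
  rewrite ExB; [|exact: squareM..].
  rewrite oD ?subr0//; last first.
    apply: measurable_wrt_sub mA; apply: filtration_le => //.
    exact: clamp_ge.
  apply: (pull_out (filtration_sigma hF s0) (filtration_meas hF s0) _ mA).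
    exact: martingale_cond_mean0.
  exact: squareM.
have -> : Ex P (fun w => (X t w - z - sp_int W S t w) ^+ 2) =
    Ex P (fun w => A w ^+ 2) + Ex P (fun w => D w ^+ 2).
  transitivity (Ex P (fun w => A w ^+ 2 + 2 * (A w * D w) + D w ^+ 2)).
    by apply: eq_Ex => w; rewrite /A /D; ring.
  have iA := sqA.2; have iD := sqDD.2; have iAD := squareM sqA sqDD.
  rewrite ExD//; last by apply: intgD => //; exact: intgZ.
  by rewrite ExD//; [rewrite ExZ// oAD mulr0 addr0|exact: intgZ].
by rewrite lerDr Ex_ge0// => w; exact: sqr_ge0.
Qed.

(** The two factors 2, from splitting off the error E and from the bracket
    bound, and the factor 6 of the Gaussian moment multiply up to 24. *)
Lemma increment_variance_simple S s t z G g a e :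
  is_simple F S -> 0 <= s -> s <= t ->
  measurable_wrt (F s) G -> (forall w, 0 <= G w <= g) ->
  (\int[P]_w \int[lambda]_(u in `[0%R, t])
     ((H u w - sp_val S u w) ^+ 2)%:E <= a%:E)%E ->
  (\int[P]_w ((X t w - z - sp_int W S t w) ^+ 2)%:E <= e%:E)%E ->
  Ex P (fun w => G w * (X t w - X s w) ^+ 2) <=
  24 * M ^+ 2 * (t - s) * Ex P G + g * (24 * a + 2 * e).
Proof.
move=> hS s0 st mG Gg ha he; have t0 := le_trans s0 st.
have Hst := simple_blocks hS s0 st.
have H0t := simple_blocks hS (lexx 0) t0.
have [sqD _ _ vD] := brownian_sumP hF hW Hst.
have [sqI _ _ _] := brownian_sumP hF hW H0t.
have bB := bracket_sum_bounded Hst.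
set D := brownian_sum _ _ _ _ in sqD vD.
set B := bracket_sum _ _ _ in vD bB.
have G0 w : 0 <= G w by case/andP: (Gg w).
have g0 : 0 <= g by have /andP[] := Gg point; exact: le_trans.
have bG : bounded_rv G.
  split; first exact: measurable_wrt_meas (filtration_meas hF s0) mG.
  by exists g => w; rewrite ger0_norm//; case/andP: (Gg w).
(* the excess of the bracket, which the L2 error of S bounds *)
pose r w := Num.max (B w - 2 * M ^+ 2 * (t - s)) 0.
have br : bounded_rv r.
  have [mB [m bm]] := bB; split.
    by apply: measurable_maxr => //; exact: measurable_funB.
  exists (m + `|2 * M ^+ 2 * (t - s)|) => w; rewrite /r.
  have [_|_] := leP (B w - 2 * M ^+ 2 * (t - s)) 0.
    by rewrite normr0 addr_ge0//; exact: le_trans (bm w).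
  by rewrite (le_trans (ler_normB _ _))// lerD2r.
have r0 w : 0 <= r w by rewrite le_max lexx orbT.
have Er : Ex P r <= 2 * a.
  have -> : Ex P r = 2 * Ex P (fun w => 2^-1 * r w).
    by rewrite ExZ; [rewrite mulVKf|exact: bounded_intg].
  rewrite ler_wpM2l// -lee_fin -Ex_EFin; last exact/intgZ/bounded_intg.
  apply: le_trans ha; apply: ge0_le_integral_any => w _.
    by rewrite lee_fin mulr_ge0.
  rewrite /r; have [_|_] := leP (B w - 2 * M ^+ 2 * (t - s)) 0.
    by rewrite mulr0 integral_ge0// => u _; rewrite lee_fin sqr_ge0.
  have [_ mono _] := hS.
  have := @bracket_le_integral _ (H ^~ w) s t (sp_time S) (sp_coef S ^~ w)
    (sp_len S) M s0 st mono (fun u h => H_bounded w (proj1 (andP h))).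
  apply: le_trans; rewrite lee_fin le_eqVlt; apply/orP; left; apply/eqP.
  by rewrite /B /bracket_sum /=; field.
have EGB : Ex P (fun w => G w * B w) <=
    2 * M ^+ 2 * (t - s) * Ex P G + g * (2 * a).
  apply: (@le_trans _ _ (Ex P (fun w => 2 * M ^+ 2 * (t - s) * G w + g * r w))).
    apply: Ex_le.
    - exact/bounded_intg/bounded_rvM.
    - by apply: intgD; exact/intgZ/bounded_intg.
    - move=> w; have /andP[_ Gle] := Gg w.
      have h1 : B w - 2 * M ^+ 2 * (t - s) <= r w by rewrite le_max lexx.
      have h2 := ler_wpM2l (G0 w) h1; have h3 := ler_wpM2r (r0 w) Gle.
      by move: h2 h3; rewrite mulrBr; lra.
  rewrite ExD ?ExZ; [|exact: bounded_intg|exact: bounded_intg|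
    exact/intgZ/bounded_intg|exact/intgZ/bounded_intg].
  by rewrite lerD2l ler_wpM2l.
have sqX : square_intg P (fun w => X t w - X s w).
  by apply: squareB; exact: X_square.
pose E w := X t w - X s w - D w.
have sqE : square_intg P E by exact: squareB.
have EE : Ex P (fun w => E w ^+ 2) <= e.
  have -> : E = fun w => X t w - X s w - (sp_int W S t w - sp_int W S s w).
    by apply/funext => w; rewrite /E /D sp_int_increment.
  apply: le_trans (increment_error_le z hS s0 st) _.
  rewrite -lee_fin -Ex_EFin//.
  suff [] : square_intg P (fun w => X t w - z - sp_int W S t w) by [].
  apply: squareB.
    apply: squareB; first exact: X_square.
    exact: (bounded_square P (bounded_cst z)).
  rewrite (_ : sp_int W S t = brownian_sum W (clamp 0 t \o sp_time S)
    (sp_coef S) (sp_len S))//.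
  by apply/funext => w; exact: sp_int_brownian_sum.
have iE := sqE.2; have iD := sqD.2; have iX := sqX.2.
have mG' : measurable_wrt (F (clamp s t (sp_time S 0))) G.
  by apply: measurable_wrt_sub mG; apply: filtration_le => //; exact: clamp_ge.
have vG := vD G mG' bG G0.
apply: (@le_trans _ _
    (Ex P (fun w => 2 * (G w * D w ^+ 2) + (2 * g) * E w ^+ 2))).
  apply: Ex_le.
  - exact: intgM_bounded.
  - by apply: intgD; apply: intgZ => //; exact: intgM_bounded.
  - move=> w; have /andP[_ Gle] := Gg w.
    have h1 := ler_wpM2r (sqr_ge0 (E w)) Gle.
    have h2 : (X t w - X s w) ^+ 2 <= 2 * D w ^+ 2 + 2 * E w ^+ 2.
      by have := sqr_ge0 (D w - E w); rewrite /E; nra.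
    by have := ler_wpM2l (G0 w) h2; lra.
rewrite ExD; last 2 first.
- by apply: intgZ; exact: intgM_bounded.
- exact: intgZ.
rewrite !ExZ//; last exact: intgM_bounded.
have := ler_wpM2l g0 EE; lra.
Qed.

(** The simple processes of the definition of the integral make both error terms
    of [increment_variance_simple] vanish in the limit. Conditionally on F_s, the
    variance of an increment is thus at most proportional to its duration. *)
Lemma increment_variance s t z G g : 0 <= s -> s <= t ->
  is_ito_integral P F W H t (fun w => X t w - z) ->
  measurable_wrt (F s) G -> (forall w, 0 <= G w <= g) ->
  Ex P (fun w => G w * (X t w - X s w) ^+ 2) <=
  24 * M ^+ 2 * (t - s) * Ex P G.
Proof.
move=> s0 st [_ _ _ [S [hS cvgH cvgX]]] mG Gg.
have g0 : 0 <= g by have /andP[] := Gg point; exact: le_trans.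
apply/ler_addgt0Pr => e e0.
pose e' := e / (26 * (g + 1)).
have e'0 : 0 < e' by rewrite divr_gt0// mulr_gt0// ltr_wpDl.
have small (u : nat -> \bar R) : u @ \oo --> 0%E ->
    \forall n \near \oo, (u n <= e'%:E)%E.
  move=> /fine_cvgP[ufin /cvgrPdist_le/(_ _ e'0) ule]; near=> n.
  have un : u n \is a fin_num by near: n.
  rewrite -(fineK un) lee_fin; apply: le_trans (ler_norm _) _.
  by rewrite -normrN -sub0r; near: n.
have [n [n1 n2]] : exists n, (\int[P]_w \int[lambda]_(u in `[0%R, t])
     ((H u w - sp_val (S n) u w) ^+ 2)%:E <= e'%:E)%E /\
  (\int[P]_w ((X t w - z - sp_int W (S n) t w) ^+ 2)%:E <= e'%:E)%E.
  have [n ?] := filter_ex (filterI (small _ cvgH) (small _ cvgX)).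
  by exists n.
apply: le_trans (increment_variance_simple (hS n) s0 st mG Gg n1 n2) _.
rewrite lerD2l -mulrDl [X in _ * (X * _)](_ : _ = 26); last by ring.
rewrite /e' mulrCA !mulrA ler_pdivrMr; last by rewrite mulr_gt0// ltr_wpDl.
nra.
Unshelve. all: by end_near. Qed.

End ito_isometry.

(** * The test function *)

Section bump.
Context {R : realType}.
Variables a b : R.
Implicit Types x y : R.

(** The square makes the second derivative positive at the end points, where the
    function itself cannot control anything. *)
Definition bump x : R := ((x - a) * (b - x)) ^+ 2.
(** This is the derivative of [bump]. *)
Definition dbump x : R := 2 * ((x - a) * (b - x)) * ((b - x) - (x - a)).

Lemma bump_ge0 x : 0 <= bump x. Proof. exact: sqr_ge0. Qed.

Lemma bump_le x : a <= x <= b -> bump x <= (b - a) ^+ 4.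
Proof.
move=> /andP[ax xb]; rewrite /bump (exprM _ 2 2) lerXn2r ?nnegrE//.
- by rewrite mulr_ge0 ?subr_ge0.
- by rewrite exprn_ge0// subr_ge0 (le_trans ax).
- by rewrite expr2 ler_pM ?subr_ge0 ?lerD2l ?lerD2r// lerN2.
Qed.

Lemma dbump_le x : a <= x <= b -> `|dbump x| <= 2 * (b - a) ^+ 3.
Proof.
move=> /andP[ax xb]; rewrite /dbump !normrM (ger0_norm (ler0n _ 2)).
rewrite -mulrA ler_wpM2l// (exprSr _ 2) expr2 -!normrM.
have u0 : 0 <= x - a by rewrite subr_ge0.
have v0 : 0 <= b - x by rewrite subr_ge0.
rewrite normrM ler_pM//.
  by rewrite ger0_norm ?mulr_ge0// ler_pM//; lra.
by rewrite ler_norml; lra.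
Qed.

(** Since [bump] vanishes to second order at both ends, its Taylor remainder is
    controlled from below by [bump x] itself, up to a fourth order term; a bound
    without the latter is impossible, as a jump may carry x to an end point. *)
Lemma bump_taylor x y : a < b -> a <= x <= b ->
  bump x + dbump x * (y - x) - 8 / (b - a) ^+ 2 * (bump x * (y - x) ^+ 2)
    - (y - x) ^+ 4 <= bump y.
Proof.
move=> ab /andP[ax xb]; rewrite /bump /dbump.
set p := (x - a) * (b - x); set q := (b - x) - (x - a); set h := y - x.
set L := b - a; have L0 : L != 0 by rewrite subr_eq0 gt_eqF.
have -> : (y - a) * (b - y) = p + q * h - h ^+ 2 by rewrite /p /q /h; ring.
have q2 : q ^+ 2 = L ^+ 2 - 4 * p by rewrite /q /L /p; ring.
rewrite -subr_ge0.
set r := (X in 0 <= X).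
have -> : r = 2 * (h * (h - q / 2)) ^+ 2 + 2^-1 * (h * (L - 4 * p / L)) ^+ 2
    + 2^-1 * h ^+ 2 * (q ^+ 2 - (L ^+ 2 - 4 * p)).
  rewrite /r; move: L0; clearbody p q h L; move=> {r q2 ab ax xb} L0.
  by field.
by rewrite q2 subrr mulr0 addr0 addr_ge0// mulr_ge0 ?sqr_ge0.
Qed.

Lemma measurable_bump : measurable_fun setT bump.
Proof.
apply: measurable_funX; apply: measurable_funM.
  exact: measurable_funB.
exact: measurable_funB.
Qed.

Lemma measurable_dbump : measurable_fun setT dbump.
Proof.
apply: measurable_funM; last by apply: measurable_funB; exact: measurable_funB.
apply: measurable_funM => //; apply: measurable_funM.
  exact: measurable_funB.
exact: measurable_funB.
Qed.

Lemma continuous_bump : continuous bump.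
Proof.
move=> x.
apply: (@cvg_comp _ _ _ (fun x => (x - a) * (b - x)) (fun x => x ^+ 2)).
  by apply: cvgM; apply: (@cvgB _ R^o); (exact: cvg_id || exact: cvg_cst).
exact: sqr_continuous.
Qed.

End bump.

(** * Survival of a discrete martingale with small conditional variance *)

Section discrete_survival.
Context {d : measure_display} {T : measurableType d} {R : realType}.
Variables (P : probability T R) (a b : R) (G : nat -> set (set T)).
Variables (Y : nat -> T -> R) (v eta delta : R).
Hypotheses (ab : a < b)
  (sG : forall i, sigma_algebra setT (G i))
  (Gm : forall i, G i `<=` measurable)
  (Gle : forall i, G i `<=` G i.+1)
  (Yab : forall i w, a <= Y i w <= b)
  (mY : forall i, measurable_wrt (G i) (Y i))
  (Y_mart : forall i, cond_mean0 P (G i) (fun w => Y i.+1 w - Y i w))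
  (Y_var : forall i (H : T -> R) g, measurable_wrt (G i) H ->
    (forall w, 0 <= H w <= g) ->
    Ex P (fun w => H w * (Y i.+1 w - Y i w) ^+ 2) <= v * Ex P H)
  (v0 : 0 <= v) (v_small : 8 / (b - a) ^+ 2 * v <= 1)
  (eta0 : 0 <= eta) (delta0 : 0 <= delta).

Local Notation L := (b - a).
Local Notation f := (bump a b).

Definition small_step i w : bool := `|Y i.+1 w - Y i w| <= eta.
Definition above i w : bool := delta <= f (Y i w).

(** Paths are killed at the first large increment, beyond which the Taylor bound
    is of no use, and at the first passage of the bump below [delta]. The second
    loses little weight, because the bump is then small; the first is rare for
    fine grids, because paths are continuous. *)
Fixpoint steps i w : bool :=
  if i is j.+1 then steps j w && small_step j w else true.
Fixpoint alive i w : bool :=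
  if i is j.+1 then [&& alive j w, small_step j w & above j.+1 w]
  else above 0 w.

Lemma alive_steps i w : alive i w -> steps i w.
Proof. by elim: i => //= i IH /and3P[/IH -> ->]. Qed.

Lemma alive_above i j w : (j <= i)%N -> alive i w -> above j w.
Proof.
elim: i => [|i IH]; first by rewrite leqn0 => /eqP ->.
by rewrite leq_eqVlt => /predU1P[->|/IH H] /and3P[// /H].
Qed.

Lemma stepsP i w : (forall j, (j < i)%N -> small_step j w) -> steps i w.
Proof.
elim: i => //= i IH H; rewrite H// andbT.
by apply: IH => j /ltnW; exact: H.
Qed.

Let ind (B : T -> bool) w : R := (B w)%:R.

Let ind_bool (H : set (set T)) (B : T -> bool) : sigma_algebra setT H ->
  H [set w | B w] -> measurable_wrt H (ind B).
Proof.
move=> sH HB; rewrite (_ : ind B = \1_[set w | B w]); last first.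
  apply/funext => w; rewrite /ind indicE.
  by case Bw: (B w); [rewrite mem_set|rewrite memNset//= Bw].
exact: measurable_wrt_indic.
Qed.

Let Gle_S i : forall H : T -> R,
  measurable_wrt (G i) H -> measurable_wrt (G i.+1) H.
Proof. by move=> H; apply: measurable_wrt_sub; exact: Gle. Qed.

Let m_above i : measurable_wrt (G i) (ind (above i)).
Proof.
apply: ind_bool => //.
rewrite [X in G i X](_ : _ = (f \o Y i) @^-1` `[delta, +oo[%classic).
  apply: measurable_wrt_preimage => //.
  apply: (measurableT_comp (measurable_bump a b)).
  exact: mY.
by apply/seteqP; split => w; rewrite /above/= in_itv/= andbT.
Qed.

Let m_small i : measurable_wrt (G i.+1) (ind (small_step i)).
Proof.
apply: ind_bool => //.
rewrite [X in G _ X](_ : _ =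
  (fun w => Y i.+1 w - Y i w) @^-1` `[- eta, eta]%classic).
  apply: measurable_wrt_preimage => //.
  by apply: measurable_wrtB; [exact: mY|apply: Gle_S; exact: mY].
by apply/seteqP; split => w; rewrite /small_step/= in_itv/= -ler_norml.
Qed.

Let m_steps i : measurable_wrt (G i) (ind (steps i)).
Proof.
elim: i => [|i IH]; first exact: measurable_wrt_cst.
rewrite (_ : ind _ = fun w => ind (steps i) w * ind (small_step i) w).
  by apply: measurable_wrtM => //; exact: Gle_S.
by apply/funext => w; rewrite /ind/=; case: (steps i w);
  rewrite ?mul1r ?mul0r.
Qed.

Let m_alive i : measurable_wrt (G i) (ind (alive i)).
Proof.
elim: i => [|i IH]; first exact: m_above.
rewrite (_ : ind _ = fun w => ind (alive i) w *
    (ind (small_step i) w * ind (above i.+1) w)).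
  by apply: measurable_wrtM; [exact: Gle_S|exact: measurable_wrtM].
by apply/funext => w; rewrite /ind/=; do 2 case: (_ w); case: (_ w);
  rewrite ?mul1r ?mul0r.
Qed.

Let ind01 B w : 0 <= ind B w <= 1.
Proof. by rewrite /ind; case: (B w); rewrite !lexx ler01. Qed.

Let bnd i (H : T -> R) (M : R) : measurable_wrt (G i) H ->
  (forall w, `|H w| <= M) -> bounded_rv H.
Proof. by move=> mH HM; split; [exact: measurable_wrt_meas mH|exists M]. Qed.

Lemma steps_bounded i : bounded_rv (fun w => (steps i w)%:R : R).
Proof.
apply: (bnd (M := 1) (@m_steps i)) => w.
by have /andP[? ?] := ind01 (steps i) w; rewrite ger0_norm.
Qed.

Lemma alive_bounded i : bounded_rv (fun w => (alive i w)%:R : R).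
Proof.
apply: (bnd (M := 1) (@m_alive i)) => w.
by have /andP[? ?] := ind01 (alive i) w; rewrite ger0_norm.
Qed.

Let b_Y i : bounded_rv (Y i).
Proof.
apply: (bnd (M := `|a| + `|b|) (@mY i)) => w; have /andP[? ?] := Yab i w.
by rewrite ler_norml; have := ler_norm a; have := ler_norm b;
  have := ler_norm (- a); have := ler_norm (- b); rewrite !normrN; lra.
Qed.

Let m_f i : measurable_wrt (G i) (f \o Y i).
Proof. by apply: (measurableT_comp (measurable_bump a b)); exact: mY. Qed.

Let b_f i : bounded_rv (f \o Y i).
Proof.
apply: (bnd (M := L ^+ 4) (@m_f i)) => w.
by rewrite ger0_norm ?bump_ge0// bump_le.
Qed.

Let m_df i : measurable_wrt (G i) (dbump a b \o Y i).
Proof. by apply: (measurableT_comp (measurable_dbump a b)); exact: mY. Qed.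

Let b_df i : bounded_rv (dbump a b \o Y i).
Proof. by apply: (bnd (@m_df i)) => w; exact: dbump_le. Qed.

Definition weight i w : R := f (Y i w) * (alive i w)%:R.

Let weight_bounded i w : 0 <= weight i w <= L ^+ 4.
Proof.
rewrite /weight mulr_ge0 ?bump_ge0//=; apply: le_trans (bump_le (Yab i w)).
by case: (alive i w); rewrite ?mulr1 ?mulr0 ?bump_ge0.
Qed.

(** The weight lost in one step is paid for by one of: the quadratic variation,
    the first large increment, the first passage below [delta], or the fourth
    order Taylor remainder, which is small for small increments. *)
Let weight_step i w :
  weight i w + ind (alive i) w * dbump a b (Y i w) * (Y i.+1 w - Y i w)
    - 8 / L ^+ 2 * (weight i w * (Y i.+1 w - Y i w) ^+ 2)
    - 3 * L ^+ 4 * (ind (steps i) w - ind (steps i.+1) w)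
    - delta * (ind (alive i) w - ind (alive i.+1) w)
    - eta ^+ 2 * (Y i.+1 w - Y i w) ^+ 2
  <= weight i.+1 w.
Proof.
rewrite /weight /ind.
have taylor := bump_taylor (Y i.+1 w) ab (Yab i w).
have f1 := bump_le (Yab i w); have f0 := bump_ge0 a b (Y i w).
have L0 : 0 <= L by rewrite subr_ge0 ltW.
have df : dbump a b (Y i w) * (Y i.+1 w - Y i w) <= 2 * L ^+ 4.
  apply: le_trans (ler_norm _) _; rewrite normrM (exprSr _ 3) mulrA.
  apply: ler_pM => //; first exact: dbump_le.
  have /andP[? ?] := Yab i w; have /andP[? ?] := Yab i.+1 w.
  by rewrite ler_norml; lra.
have C0 : 0 <= 8 / L ^+ 2 * (f (Y i w) * (Y i.+1 w - Y i w) ^+ 2).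
  apply: mulr_ge0; first by rewrite divr_ge0 ?sqr_ge0.
  by rewrite mulr_ge0 ?bump_ge0 ?sqr_ge0.
have e0 : 0 <= eta ^+ 2 * (Y i.+1 w - Y i w) ^+ 2.
  by rewrite mulr_ge0 ?sqr_ge0.
have fY0 := bump_ge0 a b (Y i.+1 w).
have small : small_step i w ->
    (Y i.+1 w - Y i w) ^+ 4 <= eta ^+ 2 * (Y i.+1 w - Y i w) ^+ 2.
  rewrite /small_step => h; rewrite (exprD _ 2 2) ler_wpM2r ?sqr_ge0//.
  by rewrite -real_normK ?num_real// lerXn2r ?nnegrE.
have above_f : ~~ above i.+1 w -> f (Y i.+1 w) < delta by rewrite -ltNge.
have L4 : 0 <= L ^+ 4 by rewrite exprn_ge0.
rewrite [alive i.+1 w]/= [steps i.+1 w]/=.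
have ind0 : false%:R = 0 :> R by [].
have ind1 : true%:R = 1 :> R by [].
have [al|nal] := boolP (alive i w); last first.
  rewrite andFb ind0 !(mulr0, mul0r, subrr, addr0, subr0, add0r).
  have : 0 <= (steps i w)%:R - (steps i w && small_step i w)%:R :> R.
    by case: (steps i w); case: (small_step i w);
      rewrite ?andbT ?andbF ?subrr ?subr0.
  by move/(mulr_ge0 (mulr_ge0 (ler0n R 3) L4)); lra.
rewrite (alive_steps al) !andTb ind1 !mulr1 mul1r.
move: (8 / L ^+ 2 * _) C0 taylor => C C0 taylor.
move: (dbump a b (Y i w) * _) df taylor => D df taylor.
have d0 : 0 <= delta := delta0.
have [sm|nsm] := boolP (small_step i w); last first.
  by rewrite andFb ind0 !mulr0 !subr0; lra.
have {small}sm4 := small sm.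
have [abv|nabv] := boolP (above i.+1 w).
  by rewrite andTb ind1 !mulr1 !subrr !mulr0 !subr0; lra.
have {above_f}lt := above_f nabv.
by rewrite andTb ind0 ind1 !subrr !mulr0 !subr0; lra.
Qed.

Lemma Ex_weight_step i :
  (1 - 8 / L ^+ 2 * v) * Ex P (weight i)
    - 3 * L ^+ 4 * (Ex P (fun w => (steps i w)%:R)
      - Ex P (fun w => (steps i.+1 w)%:R))
    - delta * (Ex P (fun w => (alive i w)%:R)
      - Ex P (fun w => (alive i.+1 w)%:R))
    - eta ^+ 2 * v
  <= Ex P (weight i.+1).
Proof.
have b_w j : bounded_rv (weight j) := bounded_rvM (b_f j) (alive_bounded j).
have m_w : measurable_wrt (G i) (weight i).
  by apply: measurable_wrtM; [exact: (@m_f i)|exact: (@m_alive i)].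
pose D w := Y i.+1 w - Y i w.
have b_D : bounded_rv D.
  apply: bounded_rvD => //; rewrite (_ : (fun _ => _) = fun w => -1 * Y i w).
    by apply: bounded_rvM => //; exact: bounded_cst.
  by apply/funext => w; rewrite mulN1r.
have b_D2 : bounded_rv (fun w => D w ^+ 2) by exact: bounded_rvM.
have b_ad : bounded_rv (fun w => ind (alive i) w * dbump a b (Y i w)).
  exact: bounded_rvM (alive_bounded i) (b_df i).
have mart0 : Ex P (fun w => (ind (alive i) w * dbump a b (Y i w)) * D w) = 0.
  apply: (pull_out (sG i) (@Gm i) (Y_mart i)).
    by apply: measurable_wrtM; [exact: (@m_alive i)|exact: (@m_df i)].
  exact/bounded_intg/bounded_rvM.
have var1 := Y_var m_w (weight_bounded i).
have var2 : Ex P (fun w => D w ^+ 2) <= v.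
  have := @Y_var i (fun=> 1) 1 (@measurable_wrt_cst _ T R (G i) 1).
  rewrite Ex_cst mulr1; under eq_Ex do rewrite mul1r.
  by apply => w; rewrite ler01 lexx.
have i1 := bounded_intg P (b_w i).
have i2 := bounded_intg P (bounded_rvM b_ad b_D).
have i3 := bounded_intg P (bounded_rvM (b_w i) b_D2).
have i4 j := bounded_intg P (steps_bounded j).
have i5 j := bounded_intg P (alive_bounded j).
have i6 := bounded_intg P b_D2.
have i7 := intgB (i4 i) (i4 i.+1).
have i8 := intgB (i5 i) (i5 i.+1).
have j1 := intgD i1 i2.
have j2 := intgB j1 (intgZ (8 / L ^+ 2) i3).
have j3 := intgB j2 (intgZ (3 * L ^+ 4) i7).
have j4 := intgB j3 (intgZ delta i8).
have j5 := intgB j4 (intgZ (eta ^+ 2) i6).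
apply: le_trans (Ex_le j5 (bounded_intg P (b_w i.+1)) (weight_step i)).
rewrite (ExB j4 (intgZ _ i6)) (ExB j3 (intgZ _ i8)) (ExB j2 (intgZ _ i7)).
rewrite (ExB j1 (intgZ _ i3)) (ExD i1 i2) mart0 addr0.
rewrite (ExZ _ i3) (ExZ _ i6) (ExZ _ i7) (ExZ _ i8).
rewrite (ExB (i4 i) (i4 i.+1)) (ExB (i5 i) (i5 i.+1)).
rewrite lerB ?ler_wpM2l ?sqr_ge0// !lerD2r mulrBl mul1r lerD2l lerN2.
by rewrite -[leRHS]mulrA ler_wpM2l// divr_ge0// sqr_ge0.
Qed.

(** Each loss of [weight_step] telescopes: it is paid at most once along a path,
    except for the quadratic variation, which is at most n v in the mean. *)
Lemma survival_lower_bound n :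
  (1 - 8 / L ^+ 2 * v) ^+ n * Ex P (weight 0)
  - 3 * L ^+ 4 * (1 - Ex P (fun w => (steps n w)%:R)) - delta
  - n%:R * (eta ^+ 2 * v)
  <= L ^+ 4 * Ex P (fun w => (alive n w)%:R).
Proof.
pose r := 1 - 8 / L ^+ 2 * v.
have r0 : 0 <= r by rewrite subr_ge0.
have r1 : r <= 1.
  by rewrite /r gerBl mulr_ge0// divr_ge0// sqr_ge0.
have L4 : 0 <= L ^+ 4 by rewrite exprn_ge0// subr_ge0 ltW.
have E01 (B : T -> bool) : bounded_rv (ind B) -> 0 <= Ex P (ind B) <= 1.
  move=> bB; rewrite Ex_ge0 => [|w]; last by have /andP[] := ind01 B w.
  rewrite -[leRHS](Ex_cst P 1) Ex_le//; [exact: bounded_intg|exact: intg_cst|].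
  by move=> w; have /andP[] := ind01 B w.
pose u i := 3 * L ^+ 4 * (1 - Ex P (ind (steps i)))
  + delta * (1 - Ex P (ind (alive i))) + i%:R * (eta ^+ 2 * v).
have u0 i : 0 <= u i.
  have /andP[_ s1] := E01 _ (steps_bounded i).
  have /andP[_ a1] := E01 _ (alive_bounded i).
  have ab' := ltW ab.
  by rewrite /u !addr_ge0// !mulr_ge0 ?subr_ge0.
have key i : r ^+ i * Ex P (weight 0) - u i <= Ex P (weight i).
  elim: i => [|i IH]; first by rewrite expr0 mul1r gerBl.
  apply: le_trans (Ex_weight_step i).
  apply: (@le_trans _ _
    (r * (r ^+ i * Ex P (weight 0) - u i) - (u i.+1 - u i))).
    by rewrite exprS -mulrA mulrBr; have := ler_wpM2r (u0 i) r1; lra.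
  rewrite -/r; have := ler_wpM2l r0 IH; rewrite /u -natr1; lra.
apply: (@le_trans _ _ (Ex P (weight n))).
  apply: le_trans (key n); rewrite -/r /u.
  have /andP[a0 _] := E01 _ (alive_bounded n).
  by have := mulr_ge0 delta0 a0; lra.
rewrite -(ExZ _ (bounded_intg P (alive_bounded n))).
apply: Ex_le.
- exact: bounded_intg (bounded_rvM (b_f n) (alive_bounded n)).
- exact/intgZ/bounded_intg/alive_bounded.
- by move=> w; rewrite /weight ler_wpM2r// bump_le.
Qed.

End discrete_survival.

(** * Equidistant grids *)

Section grids.
Context {R : realType}.
Implicit Types (f : R -> R) (c t s x e : R) (N i : nat).

Definition grid c t N i : R := c + i%:R * ((t - c) / N.+1%:R).

Lemma grid0 c t N : grid c t N 0 = c.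
Proof. by rewrite /grid mul0r addr0. Qed.

Lemma gridS c t N i : grid c t N i.+1 - grid c t N i = (t - c) / N.+1%:R.
Proof. by rewrite /grid -natr1; ring. Qed.

Lemma grid_ge c t N i : c <= t -> c <= grid c t N i.
Proof.
by move=> ct; rewrite /grid lerDl mulr_ge0// divr_ge0// subr_ge0.
Qed.

Lemma grid_le c t N i : c <= t -> (i <= N.+1)%N -> grid c t N i <= t.
Proof.
move=> ct iN; rewrite /grid -lerBrDl mulrCA ler_piMr ?subr_ge0//.
by rewrite ler_pdivrMr ?ltr0n// mul1r ler_nat.
Qed.

Lemma grid_mono c t N i : c <= t -> grid c t N i <= grid c t N i.+1.
Proof.
by move=> ct; rewrite -subr_ge0 gridS divr_ge0// subr_ge0.
Qed.

Lemma grid_approx c t N s : c <= s <= t ->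
  exists2 i, (i <= N.+1)%N & `|grid c t N i - s| <= (t - c) / N.+1%:R.
Proof.
move=> /andP[cs st]; set h := (t - c) / N.+1%:R.
have ct := le_trans cs st.
have [tc|ct'] := leP t c.
  exists 0%N => //; rewrite grid0.
  have -> : s = c by apply/eqP; rewrite eq_le cs (le_trans st).
  by rewrite subrr normr0 divr_ge0// subr_ge0.
have h0 : 0 < h by rewrite divr_gt0 ?subr_gt0// ltr0n.
have q0 : 0 <= (s - c) / h by rewrite divr_ge0 ?subr_ge0// ltW.
have /andP[iq qi] := truncn_itv q0; set i := Num.truncn _ in iq qi.
rewrite ler_pdivlMr// in iq; rewrite ltr_pdivrMr// in qi.
exists i.
  rewrite -ltnS truncn_lt_nat// ltr_pdivrMr//.
  apply: (@le_lt_trans _ _ (N.+1%:R * h)).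
    by rewrite /h mulrCA divff ?mulr1 ?lerD2r// pnatr_eq0.
  by rewrite ltr_pM2r// ltr_nat.
rewrite -natr1 in qi; rewrite /grid -/h ler_norml; apply/andP; split; lra.
Qed.

Lemma mesh_cvg0 (L : R) : L / N.+1%:R @[N --> \oo] --> (0 : R).
Proof.
by rewrite -[X in _ --> X](mulr0 L); apply: cvgMr; exact: cvg_harmonic.
Qed.

Lemma mesh_lt (L e : R) : 0 < e -> \forall N \near \oo, L / N.+1%:R < e.
Proof.
move=> e0; have /cvgrPdist_lt/(_ _ e0) := mesh_cvg0 L.
apply: filterS => N; rewrite sub0r normrN; exact: le_lt_trans (ler_norm _).
Qed.

Lemma within_continuousE f x e : {within `[0, +oo[%classic, continuous f} ->
  0 <= x -> 0 < e ->
  exists2 r, 0 < r & forall u, 0 <= u -> `|u - x| < r -> `|f u - f x| < e.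
Proof.
move=> /subspace_continuousP cf x0 e0.
have ix : `[0, +oo[%classic x by rewrite /= in_itv/= x0.
have /cvgrPdist_lt/(_ _ e0) := cf x ix.
rewrite near_withinE => /nbhs_ballP[r r0 H].
exists r => // u u0 ur; rewrite distrC; apply: H.
  by rewrite /ball/= distrC.
by rewrite /= in_itv/= u0.
Qed.

Lemma grid_below f c t s e : {within `[0, +oo[%classic, continuous f} ->
  0 <= c -> c <= s <= t -> f s < e ->
  \forall N \near \oo, exists2 i, (i <= N.+1)%N & f (grid c t N i) < e.
Proof.
move=> cf c0 cst fse; have /andP[cs st] := cst.
have ct := le_trans cs st; have s0 := le_trans c0 cs.
have fs0 : 0 < e - f s by rewrite subr_gt0.
have [r r0 H] := within_continuousE cf s0 fs0.
apply: filterS (mesh_lt (t - c) r0) => N Nr.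
have [i iN hi] := grid_approx N cst; exists i => //.
have := H (grid c t N i) (le_trans c0 (grid_ge _ _ ct)) (le_lt_trans hi Nr).
by move=> /(le_lt_trans (ler_norm _)); lra.
Qed.

(** Uniform continuity on [0, t], by compactness. *)
Lemma grid_small_steps f t e : {within `[0, +oo[%classic, continuous f} ->
  0 <= t -> 0 < e ->
  \forall N \near \oo, forall i, (i < N.+1)%N ->
    `|f (grid 0 t N i.+1) - f (grid 0 t N i)| <= e.
Proof.
move=> cf t0 e0.
pose Q (N : nat) (x : R) := 0 <= x -> forall u, 0 <= u ->
  `|u - x| <= t / N.+1%:R -> `|f u - f x| <= e.
have /compact_near_coveringP cov := @segment_compact R 0 t.
have : \forall N \near \oo, `[0, t]%classic `<=` Q N.
  apply: cov => x; rewrite /= in_itv/= => /andP[x0 xt].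
  have e2 : 0 < e / 2 by rewrite divr_gt0.
  have [r r0 H] := within_continuousE cf x0 e2.
  have r2 : 0 < r / 2 by rewrite divr_gt0.
  have nx : \forall y \near x, `|x - y| < r / 2 by exact: nbhsx_ballx.
  exists ([set y | `|x - y| < r / 2], [set N | t / N.+1%:R < r / 2]) => /=.
    by split; [exact: nx|exact: mesh_lt].
  move=> [y N] /= [xy Nr] y0 u u0 uy.
  have hy : `|f y - f x| < e / 2.
    apply: H => //; rewrite distrC (lt_trans xy)// ltr_pdivrMr//.
    by rewrite ltr_pMr// ltr1n.
  have hu : `|f u - f x| < e / 2.
    apply: H => //; rewrite -(subrK y u) -addrA.
    apply: le_lt_trans (ler_normD _ _) _.
    by rewrite [ltRHS](splitr r) ltrD// ?(le_lt_trans uy)// distrC.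
  rewrite -(subrK (f x) (f u)) -addrA (splitr e).
  apply: le_trans (ler_normD _ _) _; apply: lerD; first exact: ltW.
  by rewrite distrC ltW.
apply: filterS => N H i iN.
have g0 j : 0 <= grid 0 t N j by exact: grid_ge.
have gt : `[0, t]%classic (grid 0 t N i).
  by rewrite /= in_itv/= g0 grid_le// ltnW.
apply: (H _ gt) => //.
by rewrite gridS subr0 ger0_norm// divr_ge0.
Qed.

End grids.

(** * Passage to continuous time *)

Lemma expR_le_onem {R : realType} (x : R) : 0 <= x <= 1 / 2 ->
  expR (- (2 * x)) <= 1 - x.
Proof.
move=> /andP[x0 x1]; rewrite expRN.
have y1 : 1 <= 1 + 2 * x by lra.
apply: (@le_trans _ _ (1 + 2 * x)^-1).
  rewrite lef_pV2 ?posrE ?expR_gt0 ?(lt_le_trans ltr01 y1)//.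
  exact: expR_ge1Dx.
rewrite -div1r ler_pdivrMr ?(lt_le_trans ltr01 y1)//; nra.
Qed.

Section survival.
Context {d : measure_display} {T : measurableType d} {R : realType}.
Variables (P : probability T R) (F : R -> set (set T)) (a b z V : R).
Variable Z : R -> T -> R.
Hypotheses (hF : filtration F) (ab : a < b) (hz : a < z < b)
  (Z_ab : forall t w, 0 <= t -> a <= Z t w <= b)
  (Z_cont : forall w, continuous_path Z w)
  (Z_0 : {ae P, forall w, Z 0 w = z})
  (Z_mart : martingale P F Z) (V0 : 0 <= V)
  (Z_var : forall s t (G : T -> R) g, 0 <= s -> s <= t ->
    measurable_wrt (F s) G -> (forall w, 0 <= G w <= g) ->
    Ex P (fun w => G w * (Z t w - Z s w) ^+ 2) <= V * (t - s) * Ex P G).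

Local Notation L := (b - a).
Local Notation f := (bump a b).

Definition stays_above (c t delta : R) : set T :=
  [set w | forall s, c <= s <= t -> delta <= f (Z s w)].

Definition grid_above (c t delta : R) N : set T :=
  [set w | forall i, (i <= N.+1)%N -> delta <= f (Z (grid c t N i) w)].

Let Z_meas t : 0 <= t -> measurable_fun setT (Z t).
Proof.
move=> t0; have [aZ _ _] := Z_mart.
exact: measurable_wrt_meas (filtration_meas hF t0) (aZ t t0).
Qed.

Lemma bump_path_continuous w :
  {within `[0, +oo[%classic, continuous (fun t => f (Z t w))}.
Proof.
apply/subspace_continuousP => x x0.
have /subspace_continuousP/(_ x x0) cZ := @Z_cont w.
by apply: (cvg_comp _ _ cZ); exact: continuous_bump.
Qed.

Lemma grid_above_measurable c t delta N : 0 <= c -> c <= t ->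
  measurable (grid_above c t delta N).
Proof.
move=> c0 ct.
rewrite (_ : grid_above _ _ _ _ = \bigcap_(i in [set i | (i <= N.+1)%N])
    ((f \o Z (grid c t N i)) @^-1` `[delta, +oo[%classic)); last first.
  by apply/seteqP; split => w H i iN; have := H i iN; rewrite /= in_itv/= andbT.
apply: bigcap_measurableType => i _; rewrite -[X in measurable X]setTI.
apply: (measurableT_comp (measurable_bump a b) _) => //.
by apply: Z_meas; exact: le_trans c0 (grid_ge _ _ ct).
Qed.

Lemma stays_above_sub_grid c t delta N : c <= t ->
  stays_above c t delta `<=` grid_above c t delta N.
Proof.
by move=> ct w H i iN; apply: H; rewrite grid_ge// grid_le.
Qed.

Lemma not_stays_above c t delta w : 0 <= c -> ~ stays_above c t delta w ->
  \forall N \near \oo, ~ grid_above c t delta N w.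
Proof.
move=> c0 /existsNP[s /not_implyP[cst /negP]]; rewrite -ltNge => fs.
have := grid_below (@bump_path_continuous w) c0 cst fs.
apply: filterS => N [i iN fi] H.
by have := H i iN; rewrite leNgt fi.
Qed.

Lemma stays_aboveE c t delta : 0 <= c -> c <= t ->
  stays_above c t delta = \bigcap_N grid_above c t delta N.
Proof.
move=> c0 ct; apply/seteqP; split => w H.
  by move=> N _; exact: stays_above_sub_grid.
apply: contrapT => nH; have [N] := filter_ex (not_stays_above c0 nH).
by apply; exact: H.
Qed.

Lemma stays_above_measurable c t delta : 0 <= c -> c <= t ->
  measurable (stays_above c t delta).
Proof.
move=> c0 ct; rewrite stays_aboveE//; apply: bigcap_measurableType => N _.
exact: grid_above_measurable.
Qed.

(** By path continuity, a passage strictly below delta is seen by every fine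
    enough grid. *)
Lemma grid_above_cvg c t delta : 0 <= c -> c <= t ->
  Ex P \1_(grid_above c t delta N) @[N --> \oo] -->
  Ex P \1_(stays_above c t delta).
Proof.
move=> c0 ct; apply: (@Ex_dominated _ _ _ _ _ _ (fun=> 1)).
- by move=> N; apply: measurable_indic; exact: grid_above_measurable.
- by apply: measurable_indic; exact: stays_above_measurable.
- move=> w; have [H|nH] := pselect (stays_above c t delta w).
    apply: cvg_near_cst; apply: nearW => N.
    by rewrite !indicE !mem_set//; exact: stays_above_sub_grid.
  apply: cvg_near_cst; have := not_stays_above c0 nH.
  by apply: filterS => N nN; rewrite !indicE !memNset.
- exact: intg_cst.
- by move=> N w; rewrite indicE; case: (_ \in _); rewrite ?normr1 ?normr0.
Qed.

Local Notation chain t N := (fun i => Z (grid 0 t N i)).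

Section chain_hypotheses.
Variables (t : R) (N : nat).
Hypothesis t0 : 0 <= t.

Let g0 i : 0 <= grid 0 t N i. Proof. exact: grid_ge. Qed.

Let gS i : grid 0 t N i <= grid 0 t N i.+1. Proof. exact: grid_mono. Qed.

Let sG i : sigma_algebra setT (F (grid 0 t N i)).
Proof. exact: (filtration_sigma hF (g0 i)). Qed.

Let Gm i : F (grid 0 t N i) `<=` measurable.
Proof. exact: (filtration_meas hF (g0 i)). Qed.

Let Gle i : F (grid 0 t N i) `<=` F (grid 0 t N i.+1).
Proof. exact: (filtration_le hF (g0 i) (gS i)). Qed.

Let Yab i w : a <= chain t N i w <= b.
Proof. exact: Z_ab. Qed.

Let mY i : measurable_wrt (F (grid 0 t N i)) (chain t N i).
Proof. by have [aZ _ _] := Z_mart; exact: (aZ _ (g0 i)). Qed.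

Lemma chain_steps_bounded eta i :
  bounded_rv (fun w => (steps (chain t N) eta i w)%:R : R).
Proof. exact: (steps_bounded eta sG Gm Gle mY). Qed.

Lemma chain_survival (eta delta : R) : 0 <= eta -> 0 <= delta ->
  8 / L ^+ 2 * (V * (t / N.+1%:R)) <= 1 ->
  (1 - 8 / L ^+ 2 * (V * (t / N.+1%:R))) ^+ N.+1 *
    Ex P (fun w => f (Z 0 w) * (delta <= f (Z 0 w))%R%:R)
  - 3 * L ^+ 4 * (1 - Ex P (fun w => (steps (chain t N) eta N.+1 w)%:R))
  - delta - eta ^+ 2 * (V * t)
  <= L ^+ 4 * Ex P \1_(grid_above 0 t delta N).
Proof.
move=> e0 d0 small.
have mart i : cond_mean0 P (F (grid 0 t N i))
    (fun w => chain t N i.+1 w - chain t N i w).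
  exact: (martingale_cond_mean0 hF Z_mart (g0 i) (gS i)).
have var i (H : T -> R) g : measurable_wrt (F (grid 0 t N i)) H ->
    (forall w, 0 <= H w <= g) ->
    Ex P (fun w => H w * (chain t N i.+1 w - chain t N i w) ^+ 2)
      <= V * (t / N.+1%:R) * Ex P H.
  move=> mH Hg; apply: le_trans (Z_var (g0 i) (gS i) mH Hg) _.
  by rewrite gridS subr0.
have v0 : 0 <= V * (t / N.+1%:R) by rewrite mulr_ge0// divr_ge0.
have := survival_lower_bound ab sG Gm Gle Yab mY mart var v0 small e0 d0 N.+1.
rewrite (_ : weight a b (chain t N) eta delta 0 =
    fun w => f (Z 0 w) * (delta <= f (Z 0 w))%R%:R); last first.
  by apply/funext => w; rewrite /weight /= /above grid0.
have -> : N.+1%:R * (eta ^+ 2 * (V * (t / N.+1%:R))) = eta ^+ 2 * (V * t).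
  have : N.+1%:R != 0 :> R by rewrite pnatr_eq0.
  by move: N.+1%:R => n n0; field.
move=> /le_trans; apply; rewrite ler_wpM2l ?exprn_ge0 ?subr_ge0 ?(ltW ab)//.
apply: Ex_le.
- exact: (bounded_intg P (alive_bounded a b eta delta sG Gm Gle mY N.+1)).
- exact/bounded_intg/bounded_rv_indic/grid_above_measurable.
- move=> w; rewrite indicE.
  case al : (alive _ _ _ _ _ N.+1 w); last exact: ler0n.
  by rewrite mem_set// => i iN; exact: (alive_above iN al).
Qed.

End chain_hypotheses.

Lemma small_steps_cvg t eta : 0 <= t -> 0 < eta ->
  Ex P (fun w => (steps (chain t N) eta N.+1 w)%:R) @[N --> \oo] --> (1 : R).
Proof.
move=> t0 eta0; rewrite -[X in _ --> X](Ex_cst P 1).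
apply: (@Ex_dominated _ _ _ _ _ _ (fun=> 1)).
- by move=> N; exact: (proj1 (chain_steps_bounded N t0 eta N.+1)).
- by [].
- move=> w; apply: cvg_near_cst.
  have := grid_small_steps (@Z_cont w) t0 eta0.
  by apply: filterS => N H; rewrite (stepsP H).
- exact: intg_cst.
- by move=> N w; case: (steps _ _ _ w); rewrite ?normr1 ?normr0.
Qed.

Let bump_z_gt0 : 0 < f z.
Proof. by case/andP: hz => az zb; rewrite exprn_gt0// mulr_gt0 ?subr_gt0. Qed.

Lemma Ex_bump_start (delta : R) : delta <= f z ->
  Ex P (fun w => f (Z 0 w) * (delta <= f (Z 0 w))%R%:R) = f z.
Proof.
move=> dz; rewrite -[RHS](Ex_cst P).
have mf : measurable_fun setT (f \o Z 0).
  by apply: (measurableT_comp (measurable_bump a b)); exact: Z_meas.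
congr fine; apply: ae_eq_integral => //.
- apply/measurable_EFinP; apply: measurable_funM => //.
  rewrite (_ : (fun _ => _) = \1_((f \o Z 0) @^-1` `[delta, +oo[%classic)).
    by apply: measurable_indic; rewrite -[X in measurable X]setTI; exact: mf.
  apply/funext => w; rewrite indicE; congr (nat_of_bool _)%:R.
  by apply/idP/idP; rewrite inE/= in_itv/= andbT.
- by apply: filterS Z_0 => w /= -> _; rewrite dz mulr1.
Qed.

(** The weight decays by at most the factor kappa up to time t. Of the surviving
    kappa * f z, three quarters allow for the losses of [chain_survival]: large
    increments, the level delta and the quadratic variation each get theta. *)
Lemma stays_above_pos t : 0 <= t ->
  exists2 delta, 0 < delta & 0 < Ex P \1_(stays_above 0 t delta).
Proof.
move=> t0.
pose C := 8 / L ^+ 2; pose kappa := expR (- (2 * (C * (V * t)))).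
have L0 : 0 < L by rewrite subr_gt0.
have C0 : 0 <= C by rewrite divr_ge0// sqr_ge0.
have Vt0 : 0 <= V * t by rewrite mulr_ge0.
have k0 : 0 < kappa by exact: expR_gt0.
have k1 : kappa <= 1.
  by rewrite -[leRHS]expR0 ler_expR oppr_le0 mulr_ge0// mulr_ge0.
pose theta := kappa * f z / 4.
have th0 : 0 < theta by rewrite divr_gt0// mulr_gt0.
have thz : theta <= f z.
  rewrite /theta ler_pdivrMr// [leRHS]mulrC; apply: ler_pM => //.
  - exact: ltW.
  - exact: ltW.
  - by rewrite (le_trans k1)// ler1n.
pose eta := Num.sqrt (theta / (V * t + 1)).
have Vt1 : 0 < V * t + 1 by rewrite ltr_wpDl.
have eta0 : 0 < eta by rewrite sqrtr_gt0 divr_gt0.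
have eta2 : eta ^+ 2 * (V * t) <= theta.
  rewrite sqr_sqrtr; last by rewrite divr_ge0// ltW.
  by rewrite mulrAC ler_pdivrMr// ler_wpM2l ?(ltW th0)// lerDl.
exists theta => //.
have L4 : 0 < L ^+ 4 by rewrite exprn_gt0.
suff : theta <= L ^+ 4 * Ex P \1_(stays_above 0 t theta).
  by move=> h; have := lt_le_trans th0 h; rewrite pmulr_rgt0.
have cvg : L ^+ 4 * Ex P \1_(grid_above 0 t theta N) @[N --> \oo] -->
    L ^+ 4 * Ex P \1_(stays_above 0 t theta).
  by apply: cvgMr; exact: grid_above_cvg.
apply: (cvgr_to_ge cvg).
have e0 : 0 < theta / (3 * L ^+ 4) by rewrite divr_gt0// mulr_gt0.
have half0 : 0 < 1 / 2 :> R by rewrite divr_gt0.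
have /cvgrPdist_lt/(_ _ e0) near1 := small_steps_cvg t0 eta0.
apply: filterS2 near1 (mesh_lt (C * (V * t)) half0) => N s1 x1.
set s := Ex P _ in s1.
pose x := C * (V * (t / N.+1%:R)).
have xE : x = C * (V * t) / N.+1%:R by rewrite /x !mulrA.
have x0 : 0 <= x by rewrite xE divr_ge0// mulr_ge0.
have xle : x <= 1 / 2 by rewrite xE ltW.
have x1' : x <= 1 by lra.
have := chain_survival t0 (ltW eta0) (ltW th0) x1'.
rewrite -/s (Ex_bump_start thz) -/C -/x => surv.
have kx : kappa <= (1 - x) ^+ N.+1.
  apply: (@le_trans _ _ (expR (- (2 * x)) ^+ N.+1)).
    rewrite -expRM_natl /kappa le_eqVlt; apply/orP; left; apply/eqP.
    have N0 : N.+1%:R != 0 :> R by rewrite pnatr_eq0.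
    by congr expR; rewrite xE; move: N.+1%:R N0 => n n0; field.
  rewrite lerXn2r ?nnegrE ?expR_ge0 ?subr_ge0//.
  by apply: expR_le_onem; rewrite x0.
have kz := ler_wpM2r (ltW bump_z_gt0) kx.
have s2 : 3 * L ^+ 4 * (1 - s) <= theta.
  rewrite mulrC -ler_pdivlMr ?mulr_gt0//.
  exact: ltW (le_lt_trans (ler_norm _) s1).
have kth : kappa * f z = 4 * theta by rewrite /theta; field.
by lra.
Qed.

Lemma bump_eq0 x : (f x == 0) = (x == a) || (x == b).
Proof.
by rewrite sqrf_eq0 mulf_eq0 !subr_eq0 (eq_sym b).
Qed.

(** By path continuity at t, avoiding the end points up to and including t
    delays the hitting time beyond t. *)
Lemma lt_hitting_timeP t w : 0 < t ->
  (t%:E < hitting_time Z [set a; b] w)%E <->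
  (forall s, 0 < s <= t -> 0 < f (Z s w)).
Proof.
move=> t0; split=> [tau s /andP[s0 st]|pos].
  rewrite lt0r bump_ge0 andbT bump_eq0; apply/negP => hit.
  suff : (hitting_time Z [set a; b] w <= s%:E)%E.
    by move=> /(lt_le_trans tau); rewrite lte_fin ltNge st.
  apply: ereal_inf_lbound; exists s => //; split => //.
  by case/orP: hit => /eqP ->; [left|right].
have ft : 0 < f (Z t w) by apply: pos; rewrite t0 lexx.
have [r r0 H] := within_continuousE (@bump_path_continuous w) (ltW t0) ft.
apply: (@lt_le_trans _ _ (t + r)%:E); first by rewrite lte_fin ltrDl.
apply: le_ereal_inf_tmp => _ [s [s0 hit] <-].
rewrite lee_fin leNgt; apply/negP => str.
have f0 : f (Z s w) = 0.
  by apply/eqP; rewrite bump_eq0; case: hit => ->; rewrite eqxx ?orbT.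
have [st|ts] := leP s t.
  by have := pos s; rewrite s0 st f0 ltxx => /(_ isT).
have := H s (ltW s0); rewrite f0 sub0r normrN (gtr0_norm ft) ltxx.
move=> hs; suff : false by []; apply: hs.
by rewrite gtr0_norm ?subr_gt0// ltrBlDl.
Qed.

(** The right-hand side is measurable. The intersection over j keeps away from
    time 0, at which a null set of paths may start from an end point. *)
Lemma lt_hitting_timeE t : 0 < t ->
  [set w | (t%:E < hitting_time Z [set a; b] w)%E] =
  \bigcap_j \bigcup_m stays_above (t / j.+1%:R) t (m.+1%:R^-1).
Proof.
move=> t0; apply/seteqP; split => w /=.
  move=> /(lt_hitting_timeP w t0) pos j _.
  have c0 : 0 < t / j.+1%:R by rewrite divr_gt0.
  have ct : t / j.+1%:R <= t by rewrite ler_pdivrMr// ler_peMr ?(ltW t0) ?ler1n.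
  have cf : {within `[t / j.+1%:R, t]%classic,
      continuous (fun s => f (Z s w))}.
    apply: continuous_subspaceW (@bump_path_continuous w) => s.
    rewrite /= !in_itv/= => /andP[cs _]; rewrite andbT.
    exact: le_trans (ltW c0) cs.
  have [s] := EVT_min ct cf; rewrite in_itv/= => /andP[cs st] smin.
  have fs : 0 < f (Z s w) by apply: pos; rewrite st (lt_le_trans c0 cs).
  have [m ms] := filter_ex (mesh_lt 1 fs); exists m => // u cut.
  rewrite div1r in ms; apply: le_trans (ltW ms) _; apply: smin.
  by rewrite in_itv.
move=> H; apply/(lt_hitting_timeP w t0) => s /andP[s0 st].
have [j js] := filter_ex (mesh_lt t s0); have [m _ mH] := H j I.
by apply: lt_le_trans (mH s _); [rewrite invr_gt0|rewrite (ltW js)].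
Qed.

(** A martingale with this conditional variance bound runs through at most V t
    units of Brownian time up to t. *)
Lemma hitting_time_pos t : 0 < t ->
  (0 < P [set w | t%:E < hitting_time Z [set a; b] w])%E.
Proof.
move=> t0; have [delta delta0 pos] := stays_above_pos (ltW t0).
have mS : measurable (stays_above 0 t delta).
  by apply: stays_above_measurable => //; exact: ltW.
apply: (@lt_le_trans _ _ (P (stays_above 0 t delta))).
  by rewrite -Ex_indic// lte_fin.
apply: le_measure; rewrite ?inE//.
- rewrite lt_hitting_timeE//; apply: bigcap_measurableType => j _.
  apply: bigcup_measurable => m _; apply: stays_above_measurable.
    by rewrite divr_ge0// ltW.
  by rewrite ler_pdivrMr// ler_peMr ?(ltW t0) ?ler1n.
- move=> w H; apply/(lt_hitting_timeP w t0) => s /andP[s0 st].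
  by apply: lt_le_trans delta0 (H s _); rewrite (ltW s0).
Qed.

End survival.

Unset Implicit Arguments.
Set Strict Implicit.
Set Printing Implicit Defensive.

Theorem theorem4 (R : realType) (a b : R) (sigma : R -> R)
  (hab : a < b)
  (hsigma_ge0 : forall x, a <= x <= b -> 0 <= sigma x)
  (hsigma_a : sigma a = 0)
  (hsigma_b : sigma b = 0)
  (hsigma_gt0 : forall x, a < x < b -> 0 < sigma x)
  (hsigma_hoelder : locally_hoelder 2^-1 `]a, b[%classic sigma)
  (hsigma_bounded : [bounded sigma x | x in `[a, b]%classic])
  (d : measure_display) (T : measurableType d) (P : probability T R)
  (F : R -> set (set T)) (hF : filtration F)
  (W : R -> T -> R) (hW : brownian_motion P F W)
  (z : R) (hz : a < z < b)
  (Z : R -> T -> R)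
  (hZ_ab : forall t w, 0 <= t -> a <= Z t w <= b)
  (hZ_mart : martingale P F Z)
  (hZ_sde : sde_solution P F W sigma z Z) :
  forall t : R, 0 < t ->
    (0 < P [set w | t%:E < hitting_time Z [set a; b] w])%E.
Proof.
move=> t t0.
have [M hM] : exists M, forall x, a <= x <= b -> `|sigma x| <= M.
  have [M [_ HM]] := hsigma_bounded; exists (M + 1) => x hx.
  by apply: HM; rewrite ?ltrDl//= in_itv.
have [aZ Z_cont Z_0 Z_ito] := hZ_sde.
have Zsq s : 0 <= s -> square_intg P (Z s).
  move=> s0; apply: bounded_square; split.
    exact: measurable_wrt_meas (filtration_meas hF s0) (aZ s s0).
  exists (`|a| + `|b|) => w; have /andP[? ?] := hZ_ab s w s0.
  by rewrite ler_norml; have := ler_norm a; have := ler_norm b;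
    have := ler_norm (- a); have := ler_norm (- b); rewrite !normrN; lra.
have M0 : 0 <= 24 * M ^+ 2 by rewrite mulr_ge0// sqr_ge0.
apply: (hitting_time_pos hF hab hz hZ_ab Z_cont Z_0 hZ_mart M0) => //.
move=> s u G g s0 su mG Gg.
apply: (increment_variance hF hW hZ_mart Zsq _ s0 su (Z_ito u _) mG Gg).
- by move=> r w r0; apply: hM; exact: hZ_ab.
- exact: le_trans s0 su.
Qed.
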